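(* Let $q(x) \in \mathbb{Z}[i][x]$ be an intersective polynomial of degree $d \geq 2$ and let $N \geq 3$ be an integer. Suppose $A$ is a nonempty subset of $[N]$ such that $A$ does not contain two distinct elements whose difference equals $q(z)$ for some Gaussian integer $z$. Then \[ \frac{|A|}{N^2} \ll_q \frac{1}{(\log\log N)^{\varepsilon}}, \] where $\varepsilon>0$ is a constant depending only on $d$, and the implied constant depends only on $q$.
   Context: For a real number $X \geq 1$, $[X] := \{a+bi \in \mathbb{Z}[i] : a,b \in \mathbb{Z},\ 1 \le a,b \le X\}$; in particular $[N]$ has $N^2$ elements. A polynomial $h(x) \in \mathbb{Z}[i][x]$ is called intersective if for every nonzero Gaussian integer $\alpha$ there exists a Gaussian integer $z$ such that $\alpha$ divides $h(z)$ in $\mathbb{Z}[i]$. *)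

(* Defs.v *)
From Stdlib Require Import Reals ZArith List.
Open Scope Z_scope.

Record GI := mkGI { gre : Z; gim : Z }.

Definition gzero : GI := mkGI 0 0.
Definition gadd (x y : GI) : GI := mkGI (gre x + gre y) (gim x + gim y).
Definition gsub (x y : GI) : GI := mkGI (gre x - gre y) (gim x - gim y).
Definition gmul (x y : GI) : GI :=
  mkGI (gre x * gre y - gim x * gim y) (gre x * gim y + gim x * gre y).

Definition gdvd (alpha beta : GI) : Prop := exists gamma : GI, beta = gmul alpha gamma.

(* A polynomial in Z[i][x] is its list of coefficients, constant term first:
   [c0; c1; ...; cd] represents c0 + c1 x + ... + cd x^d. *)
Definition gpoly := list GI.

Definition peval (p : gpoly) (z : GI) : GI :=
  fold_right (fun c acc => gadd c (gmul z acc)) gzero p.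

Definition has_degree (p : gpoly) (d : nat) : Prop :=
  length p = S d /\ last p gzero <> gzero.

Definition intersective (p : gpoly) : Prop :=
  forall alpha : GI, alpha <> gzero -> exists z : GI, gdvd alpha (peval p z).

Definition in_box (N : nat) (x : GI) : Prop :=
  1 <= gre x <= Z.of_nat N /\ 1 <= gim x <= Z.of_nat N.

(* Main.v *)
Require Import Defs.
From Stdlib Require Import Reals ZArith List Lia Lra Psatz Permutation Arith.

(** A density increment that uses only the Cauchy-Schwarz inequality. Let [A] have density [delta]
    on a box [a + D [N]]. Choose [r] with [D | q(r)], so that [g(n) = q(r + D n) / D] is integral;
    the rescaled set contains no difference [g(n)]. Write [n = h_1 + ... + h_(d-1) + y] with
    integers [0 <= h_i < k] and [y] in a box [[L]], and view the rescaled set in a torus of side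
    [N + G], where [G] exceeds all the displacements that occur. If [f] denotes the balanced
    indicator function, the average of [1_A(x) f(x + g(n))] is [- delta^2]. Each application of
    Cauchy-Schwarz doubles one [h_i] and replaces [g] by one of its finite differences; after
    [d - 1] of them the map is linear in [y], and one more shows that [f] has large mean square
    on translates of [c [L]], where [c] is [d!] times the leading coefficient of [g] times the
    product of the [h_i - h_i'], which are nonzero for some choice of pairs because diagonal pairs
    have proportion [1/k]. Hence [A] has density at least [delta + eta / 2], with [eta] a power
    of [delta^2 / 8], on some box [a' + c D [L]].

    Since [c D] is polynomial in [D], and [N] may be taken polynomial in [L], [D] and [k], the
    [O(1 / eta)] possible increments cost a tower of height two in [1 / eta], which is the origin
    of the double logarithm. *)

(** * Gaussian integers *)

Definition gone : GI := mkGI 1 0.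
Definition gopp (x : GI) : GI := mkGI (- gre x) (- gim x).
Definition gofZ (n : Z) : GI := mkGI n 0.
Definition gconj (x : GI) : GI := mkGI (gre x) (- gim x).
Definition gnorm (x : GI) : Z := gre x * gre x + gim x * gim x.
(** The l1 size stays in the integers and is subadditive and submultiplicative, which suits upper
    bounds. The exactly multiplicative [gnorm] serves where a factor has to be divided out. *)
Definition gabs (x : GI) : Z := Z.abs (gre x) + Z.abs (gim x).

Lemma GI_ext (x y : GI) : gre x = gre y -> gim x = gim y -> x = y.
Proof. destruct x, y; simpl; congruence. Qed.

Lemma GI_ring_theory : ring_theory gzero gone gadd gmul gsub gopp (@eq GI).
Proof.
  constructor; intros; apply GI_ext; unfold gadd, gmul, gsub, gopp, gone, gzero;
    cbn [gre gim]; ring.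
Qed.

Add Ring GI_ring : GI_ring_theory.

Lemma GI_eq_dec (x y : GI) : {x = y} + {x <> y}.
Proof. decide equality; apply Z.eq_dec. Defined.

Lemma gnorm_nonneg (x : GI) : 0 <= gnorm x.
Proof. unfold gnorm; nia. Qed.

Lemma gnorm_gmul (x y : GI) : gnorm (gmul x y) = gnorm x * gnorm y.
Proof. unfold gnorm; simpl; ring. Qed.

Lemma gnorm_eq0 (x : GI) : gnorm x = 0 -> x = gzero.
Proof. unfold gnorm; intro H; apply GI_ext; simpl; nia. Qed.

Lemma gnorm_ge1 (x : GI) : x <> gzero -> 1 <= gnorm x.
Proof.
  intro H; pose proof (gnorm_nonneg x).
  destruct (Z.eq_dec (gnorm x) 0) as [E | E]; [| lia].
  destruct (H (gnorm_eq0 _ E)).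
Qed.

Lemma gmul_eq0 (x y : GI) : gmul x y = gzero -> x = gzero \/ y = gzero.
Proof.
  intro H; assert (E : gnorm x * gnorm y = 0) by (rewrite <- gnorm_gmul, H; reflexivity).
  apply Z.mul_eq_0 in E; destruct E; [left | right]; now apply gnorm_eq0.
Qed.

Lemma gmul_neq0 (x y : GI) : x <> gzero -> y <> gzero -> gmul x y <> gzero.
Proof. intros Hx Hy H; destruct (gmul_eq0 _ _ H); auto. Qed.

Lemma gmul_cancel_l (x y z : GI) : x <> gzero -> gmul x y = gmul x z -> y = z.
Proof.
  intros Hx H.
  assert (E : gmul x (gsub y z) = gzero)
    by (replace (gmul x (gsub y z)) with (gsub (gmul x y) (gmul x z)) by ring;
        rewrite H; ring).
  destruct (gmul_eq0 _ _ E) as [E' | E']; [contradiction |].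
  replace y with (gadd (gsub y z) z) by ring; rewrite E'; ring.
Qed.

Lemma gmul_gconj (x : GI) : gmul x (gconj x) = gofZ (gnorm x).
Proof. apply GI_ext; unfold gnorm; simpl; ring. Qed.

Lemma gabs_nonneg (x : GI) : 0 <= gabs x.
Proof. unfold gabs; lia. Qed.

Lemma gabs_ge1 (x : GI) : x <> gzero -> 1 <= gabs x.
Proof.
  intro H; pose proof (gabs_nonneg x).
  destruct (Z.eq_dec (gabs x) 0) as [E | E]; [| lia].
  destruct H; unfold gabs in *; apply GI_ext; simpl; lia.
Qed.

Lemma gabs_gadd (x y : GI) : gabs (gadd x y) <= gabs x + gabs y.
Proof. unfold gabs; cbn [gre gim gadd gsub gofZ]; lia. Qed.

Lemma gabs_gsub (x y : GI) : gabs (gsub x y) <= gabs x + gabs y.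
Proof. unfold gabs; cbn [gre gim gadd gsub gofZ]; lia. Qed.

Lemma gabs_gmul (x y : GI) : gabs (gmul x y) <= gabs x * gabs y.
Proof.
  unfold gabs; simpl.
  pose proof (Z.abs_triangle (gre x * gre y) (- (gim x * gim y))) as H1.
  pose proof (Z.abs_triangle (gre x * gim y) (gim x * gre y)) as H2.
  rewrite Z.abs_opp in H1; rewrite !Z.abs_mul in H1, H2.
  unfold Z.sub; rewrite Z.mul_add_distr_r, !Z.mul_add_distr_l.
  eapply Z.le_trans; [apply (Z.add_le_mono _ _ _ _ H1 H2) |].
  apply Z.eq_le_incl; ring.
Qed.

Lemma gabs_gofZ (n : Z) : gabs (gofZ n) = Z.abs n.
Proof. unfold gabs; cbn [gre gim gadd gsub gofZ]; lia. Qed.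

Lemma gabs_le_gnorm (x : GI) : gabs x <= gnorm x.
Proof.
  assert (H : forall a, Z.abs a <= a * a).
  { intro a; rewrite <- Z.abs_square; pose proof (Z.abs_nonneg a).
    destruct (Z.eq_dec (Z.abs a) 0) as [-> | ?]; nia. }
  unfold gabs, gnorm; pose proof (H (gre x)); pose proof (H (gim x)); lia.
Qed.

Lemma gnorm_le_gabs_sqr (x : GI) : gnorm x <= gabs x * gabs x.
Proof.
  unfold gabs, gnorm; rewrite <- (Z.abs_square (gre x)), <- (Z.abs_square (gim x)).
  pose proof (Z.abs_nonneg (gre x)); pose proof (Z.abs_nonneg (gim x)); nia.
Qed.

Lemma coord_le_of_gnorm (x : GI) (B : Z) :
  0 <= B -> gnorm x <= B * B -> Z.abs (gre x) <= B /\ Z.abs (gim x) <= B.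
Proof. unfold gnorm; intros; split; nia. Qed.

(** * Polynomial maps through finite differences *)

(* [poly_map m b phi]: [phi] is a polynomial map of degree at most [m] whose
   coefficient of degree [m] is [b]. *)
Fixpoint poly_map (m : nat) (b : GI) (phi : GI -> GI) : Prop :=
  match m with
  | O => forall n, phi n = b
  | S m' => forall s t, poly_map m' (gmul (gofZ (Z.of_nat m)) (gmul b (gsub t s)))
              (fun n => gsub (phi (gadd t n)) (phi (gadd s n)))
  end.

Lemma poly_map_ext (m : nat) (b b' : GI) (phi psi : GI -> GI) :
  b = b' -> (forall n, phi n = psi n) -> poly_map m b phi -> poly_map m b' psi.
Proof.
  intros <-; revert b phi psi; induction m as [| m IH]; simpl; intros b phi psi E H.
  - intro n; rewrite <- E; apply H.
  - intros s t; apply (IH _ _ _ (fun n => f_equal2 gsub (E _) (E _)) (H s t)).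
Qed.

Lemma poly_map_add (m : nat) (b b' : GI) (phi psi : GI -> GI) :
  poly_map m b phi -> poly_map m b' psi ->
  poly_map m (gadd b b') (fun n => gadd (phi n) (psi n)).
Proof.
  revert b b' phi psi; induction m as [| m IH]; intros b b' phi psi H H'.
  - simpl in *; intro n; rewrite H, H'; reflexivity.
  - intros s t; eapply poly_map_ext; [| | apply (IH _ _ _ _ (H s t) (H' s t))];
      [| intro n; cbv beta]; ring.
Qed.

Lemma poly_map_scale (m : nat) (a b : GI) (phi : GI -> GI) :
  poly_map m b phi -> poly_map m (gmul a b) (fun n => gmul a (phi n)).
Proof.
  revert b phi; induction m as [| m IH]; intros b phi H.
  - simpl in *; intro n; rewrite H; reflexivity.
  - intros s t; eapply poly_map_ext; [| | apply (IH _ _ (H s t))];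
      [| intro n; cbv beta]; ring.
Qed.

(** The quotient [q(r + D n) / D] is known only through its values, so its degree and leading
    coefficient are read off from its multiple by [D]. *)
Lemma poly_map_scale_inv (m : nat) (a b : GI) (phi : GI -> GI) : a <> gzero ->
  poly_map m (gmul a b) (fun n => gmul a (phi n)) -> poly_map m b phi.
Proof.
  intro Ha; revert b phi; induction m as [| m IH]; intros b phi H.
  - intro n; apply (gmul_cancel_l a); auto.
  - intros s t; apply IH; eapply poly_map_ext; [| | apply (H s t)];
      [| intro n; cbv beta]; ring.
Qed.

Lemma poly_map_shift (m : nat) (b r : GI) (phi : GI -> GI) :
  poly_map m b phi -> poly_map m b (fun n => phi (gadd r n)).
Proof.
  revert b phi; induction m as [| m IH]; intros b phi H.
  - simpl in *; intro n; apply H.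
  - intros s t; eapply poly_map_ext; [| | apply (H (gadd r s) (gadd r t))].
    + ring.
    + intro n; cbv beta; do 2 f_equal; ring.
Qed.

Fixpoint gpow (x : GI) (n : nat) : GI :=
  match n with O => gone | S n' => gmul x (gpow x n') end.

Lemma poly_map_dilate (m : nat) (b D : GI) (phi : GI -> GI) :
  poly_map m b phi -> poly_map m (gmul b (gpow D m)) (fun n => phi (gmul D n)).
Proof.
  revert b phi; induction m as [| m IH]; intros b phi H.
  - simpl in *; intro n; rewrite H; ring.
  - intros s t; eapply poly_map_ext; [| | apply (IH _ _ (H (gmul D s) (gmul D t)))].
    + simpl gpow; ring.
    + intro n; cbv beta; do 2 f_equal; ring.
Qed.

Lemma gofZ_S (m : nat) : gofZ (Z.of_nat (S m)) = gadd gone (gofZ (Z.of_nat m)).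
Proof. apply GI_ext; cbn [gre gim gofZ gadd gone]; lia. Qed.

(** A discrete product rule: the difference of [n * phi n] between the shifts [t] and [s] is [n]
    times the difference of [phi], plus [t * phi (t + n) - s * phi (s + n)]. The last two terms add
    [b * (t - s)] at top degree, which raises the factor [m] to [m + 1]. Together with
    [poly_map_const_add] this follows Horner's scheme. *)
Lemma poly_map_mulX (m : nat) (b : GI) (phi : GI -> GI) :
  poly_map m b phi -> poly_map (S m) b (fun n => gmul n (phi n)).
Proof.
  revert b phi; induction m as [| m IH]; intros b phi H s t.
  - intro n; simpl in *; rewrite !H.
    replace (mkGI 1 0) with gone by reflexivity.
    change (gofZ 1) with gone; ring.
  - pose proof (poly_map_add _ _ _ _ _
      (IH _ _ (H s t))
      (poly_map_add _ _ _ _ _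
        (poly_map_scale _ t _ _ (poly_map_shift _ _ t _ H))
        (poly_map_scale _ (gopp s) _ _ (poly_map_shift _ _ s _ H)))) as K.
    eapply poly_map_ext; [| | exact K].
    + rewrite (gofZ_S (S m)); ring.
    + intro n; cbv beta; ring.
Qed.

Lemma poly_map_const_add (m : nat) (b c : GI) (phi : GI -> GI) :
  poly_map (S m) b phi -> poly_map (S m) b (fun n => gadd c (phi n)).
Proof.
  intros H s t; eapply poly_map_ext; [| | apply (H s t)];
    [| intro n; cbv beta]; ring.
Qed.

Lemma poly_map_peval (q : gpoly) (d : nat) :
  length q = S d -> poly_map d (last q gzero) (peval q).
Proof.
  revert d; induction q as [| c q IH]; intros d H; [discriminate |].
  destruct q as [| c' q].
  - injection H as <-; intro n; simpl; ring.
  - destruct d as [| d]; [discriminate |].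
    injection H as H; apply poly_map_const_add, poly_map_mulX.
    apply IH; simpl; congruence.
Qed.

(** * Congruences, zeros and size of polynomial values *)

Lemma gdvd_peval_shift (q : gpoly) (D r n : GI) :
  gdvd D (gsub (peval q (gadd r (gmul D n))) (peval q r)).
Proof.
  induction q as [| c q [w Hw]]; simpl peval.
  - exists gzero; ring.
  - exists (gadd (gmul r w) (gmul n (peval q (gadd r (gmul D n))))).
    assert (E : peval q (gadd r (gmul D n)) = gadd (peval q r) (gmul D w))
      by (rewrite <- Hw; ring).
    rewrite E; ring.
Qed.

(** Integrality replaces analytic estimates: if [c + z * p(z) = 0] with [p(z)] nonzero, then [p(z)]
    has norm at least 1, so [gnorm z <= gnorm c]. Each Horner step therefore enlarges the radius by
    [gnorm c]. *)
Lemma peval_nonzero_outside (q : gpoly) (d : nat) : has_degree q d ->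
  exists R0, 0 <= R0 /\ forall z, R0 < gabs z -> peval q z <> gzero.
Proof.
  intros [Hl Hq]; revert d Hl Hq; induction q as [| c q IH]; intros d Hl Hq; [discriminate |].
  destruct q as [| c' q].
  - exists 0; split; [lia |]; intros z _ H; apply Hq; rewrite <- H; simpl; ring.
  - destruct d as [| d]; [discriminate |]; injection Hl as Hl.
    destruct (IH d) as [R0 [HR0 H]]; [simpl; congruence | exact Hq |].
    exists (R0 + gnorm c); split; [pose proof (gnorm_nonneg c); lia |].
    intros z Hz E; set (p := c' :: q) in *.
    change (gadd c (gmul z (peval p z)) = gzero) in E.
    assert (Hp : peval p z <> gzero) by (apply H; pose proof (gnorm_nonneg c); lia).
    assert (E' : gnorm c = gnorm z * gnorm (peval p z)).
    { rewrite <- gnorm_gmul.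
      replace c with (gopp (gmul z (peval p z))).
      - unfold gnorm; simpl; ring.
      - replace c with (gsub (gadd c (gmul z (peval p z))) (gmul z (peval p z))) by ring.
        rewrite E; ring. }
    pose proof (gnorm_ge1 _ Hp); pose proof (gabs_le_gnorm z);
    pose proof (gnorm_nonneg z); nia.
Qed.

Definition gcoef_sum (q : gpoly) : Z := fold_right (fun c s => gabs c + s) 0 q.

Lemma gcoef_sum_nonneg (q : gpoly) : 0 <= gcoef_sum q.
Proof. induction q as [| c q IH]; simpl; [| pose proof (gabs_nonneg c)]; lia. Qed.

Lemma gabs_peval (q : gpoly) (d : nat) (z : GI) (W : Z) :
  length q = S d -> 1 <= W -> gabs z <= W ->
  gabs (peval q z) <= gcoef_sum q * W ^ Z.of_nat d.
Proof.
  intros Hl HW Hz; revert d Hl; induction q as [| c q IH]; intros d Hl; [discriminate |].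
  destruct d as [| d].
  - destruct q; [| discriminate].
    simpl; pose proof (gabs_gadd c (gmul z gzero)) as H.
    replace (gmul z gzero) with gzero in * by ring.
    change (gabs gzero) with 0 in H; lia.
  - injection Hl as Hl; specialize (IH d Hl).
    change (peval (c :: q) z) with (gadd c (gmul z (peval q z))).
    change (gcoef_sum (c :: q)) with (gabs c + gcoef_sum q).
    pose proof (gabs_gadd c (gmul z (peval q z))).
    pose proof (gabs_gmul z (peval q z)).
    pose proof (gabs_nonneg c); pose proof (gabs_nonneg z);
    pose proof (gabs_nonneg (peval q z)); pose proof (gcoef_sum_nonneg q).
    rewrite Nat2Z.inj_succ, Z.pow_succ_r by lia.
    assert (1 <= W ^ Z.of_nat d) by (pose proof (Z.pow_pos_nonneg W (Z.of_nat d)); lia).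
    set (w := W ^ Z.of_nat d) in *.
    assert (gabs z * gabs (peval q z) <= W * (gcoef_sum q * w)) by (apply Z.mul_le_mono_nonneg; lia).
    assert (gabs c * 1 <= gabs c * (W * w)) by (apply Z.mul_le_mono_nonneg_l; nia).
    lia.
Qed.

(** * Averages over lists *)

Local Open Scope R_scope.

Section Averages.
Context {X : Type}.
Implicit Types (l : list X) (F G : X -> R).

Definition lsum (l : list X) (F : X -> R) : R := fold_right (fun x s => F x + s) 0 l.
(** Over the empty list the value is 0, since the inverse of 0 is 0; this keeps linearity,
    monotonicity and [avg_swap] unconditional. *)
Definition avg (l : list X) (F : X -> R) : R := lsum l F / INR (length l).

Lemma lsum_ext l F G : (forall x, In x l -> F x = G x) -> lsum l F = lsum l G.
Proof.
  induction l as [| a l IH]; simpl; intro H; [reflexivity |].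
  rewrite H, IH; auto.
Qed.

Lemma lsum_le l F G : (forall x, In x l -> F x <= G x) -> lsum l F <= lsum l G.
Proof.
  induction l as [| a l IH]; simpl; intro H; [lra |].
  apply Rplus_le_compat; auto.
Qed.

Lemma lsum_add l F G : lsum l (fun x => F x + G x) = lsum l F + lsum l G.
Proof. induction l as [| a l IH]; simpl; [| rewrite IH]; ring. Qed.

Lemma lsum_scale l F c : lsum l (fun x => c * F x) = c * lsum l F.
Proof. induction l as [| a l IH]; simpl; [| rewrite IH]; ring. Qed.

Lemma lsum_const l c : lsum l (fun _ => c) = INR (length l) * c.
Proof.
  induction l as [| a l IH]; [simpl; ring |].
  change (length (a :: l)) with (S (length l)); rewrite S_INR; simpl; rewrite IH; ring.
Qed.

Lemma lsum_app l m F : lsum (l ++ m) F = lsum l F + lsum m F.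
Proof. induction l as [| a l IH]; simpl; [| rewrite IH]; ring. Qed.

Lemma lsum_nonneg l F : (forall x, In x l -> 0 <= F x) -> 0 <= lsum l F.
Proof. intro H; pose proof (lsum_le l _ _ H) as K; rewrite lsum_const in K; lra. Qed.

Lemma lsum_incl l m F : NoDup l -> incl l m -> (forall x, 0 <= F x) -> lsum l F <= lsum m F.
Proof.
  intros Hl; revert m; induction Hl as [| a l Ha Hl IH]; intros m Hi HF.
  - apply lsum_nonneg; auto.
  - destruct (in_split a m (Hi a (or_introl eq_refl))) as [m1 [m2 ->]].
    rewrite lsum_app; simpl.
    enough (lsum l F <= lsum (m1 ++ m2) F) by (rewrite lsum_app in *; lra).
    apply IH; auto; intros x Hx.
    specialize (Hi x (or_intror Hx)); rewrite in_app_iff in *; simpl in Hi.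
    destruct Hi as [| [-> |]]; tauto.
Qed.

Lemma lsum_perm l m F : Permutation l m -> lsum l F = lsum m F.
Proof. induction 1; simpl; lra. Qed.

Lemma avg_ext l F G : (forall x, In x l -> F x = G x) -> avg l F = avg l G.
Proof. intro H; unfold avg; now rewrite (lsum_ext _ _ _ H). Qed.

Lemma inv_length_nonneg l : 0 <= / INR (length l).
Proof.
  destruct l as [| a l]; [simpl; rewrite Rinv_0; lra |].
  left; apply Rinv_0_lt_compat, lt_0_INR; simpl; lia.
Qed.

Lemma avg_le l F G : (forall x, In x l -> F x <= G x) -> avg l F <= avg l G.
Proof.
  intro H; apply Rmult_le_compat_r; [apply inv_length_nonneg | now apply lsum_le].
Qed.

Lemma avg_add l F G : avg l (fun x => F x + G x) = avg l F + avg l G.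
Proof. unfold avg; rewrite lsum_add; unfold Rdiv; ring. Qed.

Lemma avg_scale l F c : avg l (fun x => c * F x) = c * avg l F.
Proof. unfold avg; rewrite lsum_scale; unfold Rdiv; ring. Qed.

Lemma avg_const l c : l <> nil -> avg l (fun _ => c) = c.
Proof.
  intro H; unfold avg; rewrite lsum_const; field.
  destruct l; [contradiction | apply not_0_INR; discriminate].
Qed.

Lemma avg_nonneg l F : (forall x, In x l -> 0 <= F x) -> 0 <= avg l F.
Proof.
  intro H; apply Rmult_le_pos; [now apply lsum_nonneg | apply inv_length_nonneg].
Qed.

Lemma avg_exists l F t : l <> nil -> t <= avg l F -> exists x, In x l /\ t <= F x.
Proof.
  intros Hl H.
  assert (K : INR (length l) * t <= lsum l F).
  { assert (P : 0 < INR (length l)) by (apply lt_0_INR; destruct l; [contradiction | simpl; lia]).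
    unfold avg in H; apply (Rmult_le_compat_l _ _ _ (Rlt_le _ _ P)) in H.
    replace (INR (length l) * (lsum l F / INR (length l))) with (lsum l F) in H by (field; lra).
    exact H. }
  clear H; induction l as [| a l IH]; [contradiction |].
  destruct (Rle_lt_dec t (F a)) as [Ha | Ha]; [exists a; simpl; auto |].
  change (length (a :: l)) with (S (length l)) in K; rewrite S_INR in K; simpl in K.
  destruct l as [| b l]; [simpl in K; lra |].
  destruct IH as [x [Hx Hx']]; [discriminate | lra |].
  exists x; split; [now right | exact Hx'].
Qed.

(** With [m] the average of [u F], the inequality [(F - m u)^2 >= 0] and [u^2 <= 1] give
    [F^2 >= 2 m u F - m^2] pointwise; averaging leaves [m^2] on the right. *)
Lemma avg_cauchy_schwarz l u F : l <> nil -> (forall x, Rabs (u x) <= 1) ->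
  (avg l (fun x => u x * F x)) ^ 2 <= avg l (fun x => F x ^ 2).
Proof.
  intros Hl Hu; set (m := avg l (fun x => u x * F x)).
  assert (K : 2 * m * m + - m ^ 2 * 1 <= avg l (fun x => F x ^ 2)).
  { rewrite <- (avg_const l 1 Hl) at 1; unfold m at 2.
    rewrite <- !avg_scale, <- avg_add.
    apply avg_le; intros x _.
    assert (Hux : u x ^ 2 <= 1)
      by (specialize (Hu x); rewrite <- pow2_abs; pose proof (Rabs_pos (u x)); nra).
    pose proof (pow2_ge_0 (F x - m * u x)); pose proof (pow2_ge_0 m); nra. }
  lra.
Qed.

End Averages.

Section DoubleAverages.
Context {X Y : Type}.
Implicit Types (l : list X) (m : list Y).

Lemma lsum_swap l m (F : X -> Y -> R) :
  lsum l (fun x => lsum m (F x)) = lsum m (fun y => lsum l (fun x => F x y)).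
Proof.
  induction l as [| a l IH]; simpl.
  - rewrite lsum_const; ring.
  - rewrite IH, <- lsum_add; reflexivity.
Qed.

Lemma avg_swap l m (F : X -> Y -> R) :
  avg l (fun x => avg m (F x)) = avg m (fun y => avg l (fun x => F x y)).
Proof.
  unfold avg, Rdiv.
  rewrite (lsum_ext l _ (fun x => / INR (length m) * lsum m (F x))) by (intros; ring).
  rewrite (lsum_ext m _ (fun y => / INR (length l) * lsum l (fun x => F x y))) by (intros; ring).
  rewrite !lsum_scale, lsum_swap; ring.
Qed.

Lemma lsum_map (g : X -> Y) l (F : Y -> R) : lsum (map g l) F = lsum l (fun x => F (g x)).
Proof. induction l as [| a l IH]; simpl; [| rewrite IH]; reflexivity. Qed.

Lemma avg_map (g : X -> Y) l (F : Y -> R) : avg (map g l) F = avg l (fun x => F (g x)).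
Proof. unfold avg; now rewrite lsum_map, length_map. Qed.

End DoubleAverages.

Lemma avg_list_prod {X Y} (l : list X) (m : list Y) (F : X * Y -> R) :
  avg (list_prod l m) F = avg l (fun x => avg m (fun y => F (x, y))).
Proof.
  unfold avg, Rdiv; rewrite length_prod, mult_INR, Rinv_mult.
  rewrite (lsum_ext l _ (fun x => / INR (length m) * lsum m (fun y => F (x, y))))
    by (intros; ring).
  rewrite lsum_scale.
  enough (E : lsum (list_prod l m) F = lsum l (fun x => lsum m (fun y => F (x, y))))
    by (rewrite E; ring).
  induction l as [| a l IH]; simpl; [reflexivity |].
  rewrite lsum_app, lsum_map, IH; reflexivity.
Qed.

Lemma avg_sqr {X} (l : list X) (F : X -> R) :
  (avg l F) ^ 2 = avg l (fun x => avg l (fun y => F x * F y)).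
Proof.
  transitivity (avg l (fun x => avg l F * F x)).
  - rewrite avg_scale; ring.
  - apply avg_ext; intros x _; rewrite avg_scale; ring.
Qed.

(** * Boxes and tori *)

Definition zrange (lo : Z) (n : nat) : list Z := map (fun i => (lo + Z.of_nat i)%Z) (seq 0 n).

Definition grid (lo : Z) (n : nat) : list GI :=
  map (fun p => mkGI (fst p) (snd p)) (list_prod (zrange lo n) (zrange lo n)).

Lemma in_zrange lo n z : In z (zrange lo n) <-> (lo <= z < lo + Z.of_nat n)%Z.
Proof.
  unfold zrange; rewrite in_map_iff; split.
  - intros [i [<- Hi]]; apply in_seq in Hi; lia.
  - intro H; exists (Z.to_nat (z - lo)); split; [lia | apply in_seq; lia].
Qed.

Lemma in_grid lo n x : In x (grid lo n) <->
  (lo <= gre x < lo + Z.of_nat n)%Z /\ (lo <= gim x < lo + Z.of_nat n)%Z.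
Proof.
  unfold grid; rewrite in_map_iff; split.
  - intros [[a b] [<- H]]; apply in_prod_iff in H; rewrite !in_zrange in H; exact H.
  - intro H; exists (gre x, gim x); split; [now destruct x |].
    apply in_prod_iff; now rewrite !in_zrange.
Qed.

Lemma NoDup_list_prod {X Y} (l : list X) (m : list Y) :
  NoDup l -> NoDup m -> NoDup (list_prod l m).
Proof.
  intros Hl Hm; induction Hl as [| a l Ha Hl IH]; simpl; [constructor |].
  apply NoDup_app; [| exact IH |].
  - apply FinFun.Injective_map_NoDup; [intros x y E; congruence | exact Hm].
  - intros [x y] H H'; apply in_map_iff in H; destruct H as [z [E _]].
    apply in_prod_iff in H'; injection E as -> _; tauto.
Qed.

Lemma NoDup_zrange lo n : NoDup (zrange lo n).
Proof.
  apply FinFun.Injective_map_NoDup; [intros x y E; lia | apply seq_NoDup].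
Qed.

Lemma NoDup_grid lo n : NoDup (grid lo n).
Proof.
  apply FinFun.Injective_map_NoDup.
  - intros [a b] [a' b'] E; simpl in E; congruence.
  - apply NoDup_list_prod; apply NoDup_zrange.
Qed.

Lemma length_grid lo n : length (grid lo n) = (n * n)%nat.
Proof. unfold grid, zrange; now rewrite length_map, length_prod, length_map, length_seq. Qed.

Lemma grid_neq_nil lo n : (1 <= n)%nat -> grid lo n <> nil.
Proof. intros H E; pose proof (length_grid lo n) as K; rewrite E in K; simpl in K; nia. Qed.

Definition gmod (P : nat) (x : GI) : GI :=
  mkGI (gre x mod Z.of_nat P) (gim x mod Z.of_nat P).

(** Functions on the torus are functions on all of Z[i] that factor through reduction modulo [P];
    averages over the torus are taken over the representatives [grid 0 P]. *)
Definition periodic (P : nat) (F : GI -> R) : Prop := forall x, F (gmod P x) = F x.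

Lemma mod_add_inj (p a x y : Z) : (0 <= x < p)%Z -> (0 <= y < p)%Z ->
  ((x + a) mod p = (y + a) mod p -> x = y)%Z.
Proof.
  intros Hx Hy E.
  pose proof (Z.div_mod (x + a) p ltac:(lia)) as H1.
  pose proof (Z.div_mod (y + a) p ltac:(lia)) as H2.
  assert (H : (x - y = p * ((x + a) / p - (y + a) / p))%Z) by lia.
  destruct (Z.lt_trichotomy ((x + a) / p - (y + a) / p) 0) as [? | [? | ?]]; nia.
Qed.


Lemma gmod_gadd_l P x a : (1 <= P)%nat -> gmod P (gadd (gmod P x) a) = gmod P (gadd x a).
Proof. intro; unfold gmod, gadd; cbn [gre gim]; now rewrite !Zplus_mod_idemp_l. Qed.

(** Translation followed by reduction is an injective map of [grid 0 P] into itself, hence a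
    permutation of it. *)
Lemma avg_translate P F a : (1 <= P)%nat -> periodic P F ->
  avg (grid 0 P) (fun x => F (gadd x a)) = avg (grid 0 P) F.
Proof.
  intros HP HF.
  rewrite (avg_ext _ _ (fun x => F (gmod P (gadd x a)))) by (intros; now rewrite HF).
  rewrite <- (avg_map (fun x => gmod P (gadd x a)) (grid 0 P) F).
  unfold avg; rewrite length_map; f_equal; apply lsum_perm, Permutation_map_same_l.
  - apply FinFun.Injective_map_NoDup_in; [| apply NoDup_grid].
    intros x y Hx Hy E; apply in_grid in Hx, Hy; injection E as E1 E2.
    apply GI_ext; [apply (mod_add_inj (Z.of_nat P) (gre a)) | apply (mod_add_inj (Z.of_nat P) (gim a))];
      (lia || assumption).
  - intros y Hy; apply in_map_iff in Hy; destruct Hy as [x [<- _]]; apply in_grid; cbn [gre gim gmod].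
    split; apply Z.mod_pos_bound; lia.
Qed.

Lemma periodic_translate P F a : (1 <= P)%nat -> periodic P F ->
  periodic P (fun x => F (gadd x a)).
Proof. intros HP HF x; rewrite <- HF, gmod_gadd_l, HF by exact HP; reflexivity. Qed.

(** * Weyl differencing in physical space *)

Definition zbox (k : nat) : list GI := map (fun i => gofZ (Z.of_nat i)) (seq 0 k).

(* The multiset of sums [h_1 + ... + h_m + y] with [0 <= h_i < k] and [1 <= Re y, Im y <= L]. *)
Fixpoint sumbox (k L m : nat) : list GI :=
  match m with
  | O => grid 1 L
  | S m' => map (fun p => gadd (fst p) (snd p)) (list_prod (zbox k) (sumbox k L m'))
  end.

Lemma avg_sumbox_S k L m F :
  avg (sumbox k L (S m)) F = avg (zbox k) (fun h => avg (sumbox k L m) (fun n => F (gadd h n))).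
Proof. simpl; rewrite avg_map, avg_list_prod; reflexivity. Qed.

Lemma in_zbox k h : In h (zbox k) -> (0 <= gre h < Z.of_nat k)%Z /\ gim h = 0%Z.
Proof.
  unfold zbox; rewrite in_map_iff; intros [i [<- Hi]]; apply in_seq in Hi; simpl; lia.
Qed.

Lemma length_zbox k : length (zbox k) = k.
Proof. unfold zbox; now rewrite length_map, length_seq. Qed.

Lemma zbox_neq_nil k : (1 <= k)%nat -> zbox k <> nil.
Proof. intros H E; pose proof (length_zbox k) as K; rewrite E in K; simpl in K; lia. Qed.

Lemma sumbox_neq_nil k L m : (1 <= k)%nat -> (1 <= L)%nat -> sumbox k L m <> nil.
Proof.
  intros Hk HL; induction m as [| m IH]; simpl; [now apply grid_neq_nil |].
  intro E; apply (f_equal (@length _)) in E; rewrite length_map, length_prod, length_zbox in E.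
  simpl in E; destruct (sumbox k L m); [contradiction | simpl in E; nia].
Qed.

(** The lower bound on the real part, preserved because the [h_i] are nonnegative, later keeps
    [r + D n] away from the zeros of [q]. *)
Lemma in_sumbox k L m n : In n (sumbox k L m) ->
  (1 <= gre n)%Z /\ (gabs n <= Z.of_nat m * Z.of_nat k + 2 * Z.of_nat L)%Z.
Proof.
  revert n; induction m as [| m IH]; intros n H.
  - simpl in H; apply in_grid in H; unfold gabs; lia.
  - simpl in H; apply in_map_iff in H; destruct H as [[h y] [<- H]]; cbn [fst snd].
    apply in_prod_iff in H; destruct H as [H1 H2]; apply in_zbox in H1; apply IH in H2.
    unfold gabs in *; cbn [gre gim gadd]; lia.
Qed.

Lemma avg_diag k h : (1 <= k)%nat ->
  avg (zbox k) (fun h' => if GI_eq_dec h h' then 1 else 0) <= / INR k.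
Proof.
  intro Hk; unfold avg; rewrite length_zbox.
  rewrite <- (Rmult_1_l (/ INR k)); apply Rmult_le_compat_r;
    [left; apply Rinv_0_lt_compat, lt_0_INR; lia |].
  assert (H : NoDup (zbox k)).
  { apply FinFun.Injective_map_NoDup; [| apply seq_NoDup].
    intros x y E; injection E; lia. }
  induction H as [| a l Ha H IH]; simpl; [lra |].
  destruct (GI_eq_dec h a) as [-> |]; [| lra].
  rewrite (lsum_ext l _ (fun _ => 0)), lsum_const; [lra |].
  intros x Hx; destruct (GI_eq_dec a x) as [-> |]; [contradiction | reflexivity].
Qed.

Lemma avg_le_1 {X} (l : list X) F : l <> nil -> (forall x, F x <= 1) -> avg l F <= 1.
Proof. intros Hl H; rewrite <- (avg_const l 1 Hl); apply avg_le; auto. Qed.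

Lemma Rabs_le_inv (x y : R) : Rabs x <= y -> - y <= x <= y.
Proof.
  intro H; pose proof (Rle_abs x); pose proof (Rle_abs (- x)); rewrite Rabs_Ropp in *; lra.
Qed.

Lemma Rabs_avg_le {X} (l : list X) F : l <> nil -> (forall x, Rabs (F x) <= 1) -> Rabs (avg l F) <= 1.
Proof.
  intros Hl H; apply Rabs_le; split.
  - apply Rle_trans with (avg l (fun _ => -1)); [rewrite avg_const; auto; lra |].
    apply avg_le; intros x _.
    specialize (H x); apply Rabs_le_inv in H; lra.
  - apply avg_le_1; auto; intro x; specialize (H x); apply Rabs_le_inv in H; lra.
Qed.

(* Only a proportion [1/k] of the pairs is diagonal. *)
Lemma off_diagonal_exists k z (F : GI -> GI -> R) : (1 <= k)%nat -> 0 < z ->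
  / INR k <= z -> (forall h h', F h h' <= 1) ->
  4 * z <= avg (zbox k) (fun h => avg (zbox k) (F h)) ->
  exists h h', In h (zbox k) /\ In h' (zbox k) /\ h <> h' /\ 2 * z <= F h h'.
Proof.
  intros Hk Hz Hkz HF H.
  pose proof (zbox_neq_nil k Hk) as Hnil.
  destruct (avg_exists (zbox k) _ _ Hnil H) as [h [Hh Hh']].
  (* Subtracting the diagonal indicator costs at most [1/k <= z]. At [h' = h] the corrected value is
     at most 0, so an [h'] where it reaches [2 * z] differs from [h]. *)
  set (dg := fun h' => if GI_eq_dec h h' then 1 else 0).
  assert (E : 2 * z <= avg (zbox k) (fun h' => F h h' + -1 * dg h')).
  { rewrite avg_add, avg_scale; pose proof (avg_diag k h Hk) as K; fold dg in K; lra. }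
  destruct (avg_exists (zbox k) _ _ Hnil E) as [h' [Hh1 Hh2]].
  exists h, h'; repeat split; auto; unfold dg in Hh2;
    destruct (GI_eq_dec h h'); try lra; auto.
  specialize (HF h h'); lra.
Qed.

Lemma pow_le_self (w : R) (n : nat) : 0 <= w <= 1 -> n <> O -> w ^ n <= w.
Proof.
  intros Hw Hn; destruct n as [| n]; [contradiction | simpl].
  pose proof (pow_incr w 1 n Hw); rewrite pow1 in *; nra.
Qed.

(** The factor 2 makes the induction close: squaring [2 z] gives [4 z^2], passing to an off-diagonal
    pair keeps [2 z^2], and the hypothesis recurs with [z^2] for [z]. The weight [u] is an arbitrary
    bounded function at the start and becomes [f] itself after one differencing. *)
Lemma weyl_differencing (P k L m : nat) (b : GI) (phi : GI -> GI) (f u : GI -> R) (z : R) :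
  (1 <= P)%nat -> (1 <= k)%nat -> (1 <= L)%nat ->
  poly_map (S m) b phi -> b <> gzero ->
  periodic P f -> (forall x, Rabs (f x) <= 1) -> (forall x, Rabs (u x) <= 1) ->
  0 < z <= 1 -> / INR k <= z ^ (2 ^ S m) ->
  2 * z <= Rabs (avg (grid 0 P) (fun x => u x * avg (sumbox k L m) (fun n => f (gadd x (phi n))))) ->
  exists c, c <> gzero /\
    (gabs c <= Z.of_nat (fact (S m)) * Z.of_nat k ^ Z.of_nat m * gabs b)%Z /\
    2 * z ^ (2 ^ S m) <= avg (grid 0 P) (fun x => (avg (grid 1 L) (fun y => f (gadd x (gmul c y)))) ^ 2).
Proof.
  intros HP Hk HL; revert b phi u z; induction m as [| m IH];
    intros b phi u z Hphi Hb Hf Hf1 Hu Hz Hkz H.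
  - exists b; split; [exact Hb | split; [change (fact 1) with 1%nat; rewrite Z.pow_0_r; lia |]].
    (* A map of degree one is affine; its constant term is absorbed by translation invariance on the
       torus. *)
    assert (E : forall n, phi n = gadd (phi gzero) (gmul b n)).
    { intro n; pose proof (Hphi gzero n gzero) as E; cbv beta in E.
      replace (gadd n gzero) with n in E by ring.
      replace (gadd gzero gzero) with gzero in E by ring.
      replace (phi n) with (gadd (phi gzero) (gsub (phi n) (phi gzero))) by ring.
      rewrite E; change (gofZ (Z.of_nat 1)) with gone; ring. }
    set (g := fun x => avg (grid 1 L) (fun y => f (gadd x (gmul b y)))).
    assert (Hg : periodic P (fun x => g x ^ 2)).
    { intro x; unfold g; f_equal; apply avg_ext; intros y _.
      apply (periodic_translate P f (gmul b y) HP Hf x). }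
    pose proof (avg_cauchy_schwarz (grid 0 P) u (fun x => g (gadd x (phi gzero)))
                  (grid_neq_nil 0 P HP) Hu) as K.
    cbv beta in K; rewrite (avg_translate P (fun x => g x ^ 2) (phi gzero) HP Hg) in K.
    change (2 ^ 1)%nat with 2%nat; eapply Rle_trans; [| exact K].
    assert (E' : avg (grid 0 P) (fun x => u x * g (gadd x (phi gzero))) =
       avg (grid 0 P) (fun x => u x * avg (sumbox k L 0) (fun n => f (gadd x (phi n))))).
    { apply avg_ext; intros x _; f_equal; apply avg_ext; intros y _; rewrite (E y); f_equal; ring. }
    rewrite E', <- (pow2_abs (avg _ _)).
    pose proof (pow_incr _ _ 2 (conj (Rmult_le_pos 2 z ltac:(lra) ltac:(lra)) H)) as K2.
    pose proof (pow2_ge_0 z); lra.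
  - set (F := fun x n => avg (zbox k) (fun h => f (gadd x (phi (gadd h n))))).
    set (psi := fun s t n => gsub (phi (gadd t n)) (phi (gadd s n))).
    set (W := fun s t => avg (grid 0 P)
                (fun x => f x * avg (sumbox k L m) (fun n => f (gadd x (psi s t n))))).
    assert (Hsum := sumbox_neq_nil k L m Hk HL).
    assert (HT := grid_neq_nil 0 P HP).
    (* Expand the square over pairs [s], [t] and substitute [x - phi (s + n)] for [x]: the first
       factor becomes [f x], and the second is displaced by the difference [psi s t n]. *)
    assert (HW : avg (grid 0 P) (fun x => avg (sumbox k L m) (fun n => F x n ^ 2)) =
                 avg (zbox k) (fun s => avg (zbox k) (fun t => W s t))).
    { transitivity (avg (grid 0 P) (fun x => avg (zbox k) (fun s => avg (zbox k) (fun t =>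
         avg (sumbox k L m) (fun n => f (gadd x (phi (gadd s n))) * f (gadd x (phi (gadd t n)))))))).
      - apply avg_ext; intros x _.
        rewrite (avg_ext _ _ (fun n => avg (zbox k) (fun s => avg (zbox k) (fun t =>
           f (gadd x (phi (gadd s n))) * f (gadd x (phi (gadd t n)))))))
          by (intros n _; apply avg_sqr).
        rewrite avg_swap; apply avg_ext; intros s _; apply avg_swap.
      - rewrite avg_swap; apply avg_ext; intros s _.
        rewrite avg_swap; apply avg_ext; intros t _.
        unfold W.
        rewrite avg_swap.
        rewrite (avg_ext (grid 0 P) (fun x => f x * _) (fun x => avg (sumbox k L m)
                   (fun n => f x * f (gadd x (psi s t n)))))
          by (intros; now rewrite avg_scale).
        rewrite (avg_swap (grid 0 P)); apply avg_ext; intros n _.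
        rewrite <- (avg_translate P (fun x => f x * f (gadd x (psi s t n))) (phi (gadd s n)) HP).
        + apply avg_ext; intros x _; f_equal; f_equal; unfold psi; ring.
        + intro x; rewrite Hf; f_equal; apply (periodic_translate P f _ HP Hf x). }
    (* Cauchy-Schwarz is used twice: over [x] to remove [u], then over [n] with weight 1 to bring
       the square inside the inner average. *)
    assert (HCS : 4 * z ^ 2 <= avg (zbox k) (fun s => avg (zbox k) (fun t => W s t))).
    { rewrite <- HW.
      apply Rle_trans with ((avg (grid 0 P) (fun x => u x * avg (sumbox k L m) (F x))) ^ 2).
      - rewrite <- (pow2_abs (avg _ _)).
        rewrite (avg_ext (grid 0 P) _ (fun x => u x * avg (sumbox k L (S m)) (fun n => f (gadd x (phi n))))).
        + pose proof (pow_incr _ _ 2 (conj (Rmult_le_pos 2 z ltac:(lra) ltac:(lra)) H)); lra.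
        + intros x _; f_equal; rewrite avg_sumbox_S; apply avg_swap.
      - eapply Rle_trans; [apply (avg_cauchy_schwarz _ u); auto |].
        apply avg_le; intros x _.
        pose proof (avg_cauchy_schwarz (sumbox k L m) (fun _ => 1) (F x) Hsum) as K.
        rewrite (avg_ext (sumbox k L m) (F x) (fun n => 1 * F x n)) by (intros; ring).
        apply K; intro; rewrite Rabs_R1; lra. }
    assert (HW1 : forall s t, Rabs (W s t) <= 1).
    { intros s t; apply Rabs_avg_le; auto; intro x; rewrite Rabs_mult.
      assert (Rabs (avg (sumbox k L m) (fun n => f (gadd x (psi s t n)))) <= 1)
        by (apply Rabs_avg_le; auto).
      pose proof (Rabs_pos (f x)); specialize (Hf1 x).
      pose proof (Rabs_pos (avg (sumbox k L m) (fun n => f (gadd x (psi s t n))))); nra. }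
    assert (Hpow : z ^ (2 ^ S (S m)) = (z ^ 2) ^ (2 ^ S m))
      by (rewrite <- pow_mult; f_equal; simpl; lia).
    rewrite Hpow in *.
    assert (Hz2 : 0 < z ^ 2 <= 1) by (simpl; nra).
    destruct (off_diagonal_exists k (z ^ 2) W Hk) as [s [t [Hs [Ht [Hst HF]]]]]; auto.
    + lra.
    + eapply Rle_trans; [exact Hkz |].
      apply pow_le_self; [lra | apply Nat.pow_nonzero; lia].
    + intros s t; specialize (HW1 s t); apply Rabs_le_inv in HW1; lra.
    + destruct (IH (gmul (gofZ (Z.of_nat (S (S m)))) (gmul b (gsub t s))) (psi s t) f (z ^ 2))
        as [c [Hc [Hcb Hcf]]]; auto.
      * apply gmul_neq0; [discriminate | apply gmul_neq0; auto].
        intro E; apply Hst; replace t with (gadd (gsub t s) s) by ring; rewrite E; ring.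
      * eapply Rle_trans; [exact HF | apply Rle_abs].
      * exists c; split; [exact Hc | split; [| exact Hcf]].
        eapply Z.le_trans; [exact Hcb |].
        (* Each differencing multiplies the leading coefficient by the current degree and by
           [t - s], of size at most [k]; this accumulates to the factorial and the power of [k]. *)
        assert (Hts : (gabs (gsub t s) <= Z.of_nat k)%Z).
        { apply in_zbox in Hs, Ht; unfold gabs; cbn [gre gim gsub]; lia. }
        assert (Hb' : (gabs (gmul (gofZ (Z.of_nat (S (S m)))) (gmul b (gsub t s)))
                        <= Z.of_nat (S (S m)) * (gabs b * Z.of_nat k))%Z).
        { eapply Z.le_trans; [apply gabs_gmul |]; rewrite gabs_gofZ, Z.abs_eq by lia.
          apply Z.mul_le_mono_nonneg_l; [lia |].
          eapply Z.le_trans; [apply gabs_gmul |].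
          apply Z.mul_le_mono_nonneg_l; [apply gabs_nonneg | exact Hts]. }
        eapply Z.le_trans; [apply Z.mul_le_mono_nonneg_l; [| exact Hb'] |].
        -- apply Z.mul_nonneg_nonneg; [lia | apply Z.pow_nonneg; lia].
        -- apply Z.eq_le_incl.
           change (fact (S (S m))) with ((S (S m)) * fact (S m))%nat.
           rewrite (Nat2Z.inj_mul (S (S m))), (Nat2Z.inj_succ m), Z.pow_succ_r by lia; ring.
Qed.

(** * The density increment *)

(* The torus exceeds the box by a margin [G], so displacements smaller than [G] never wrap
   around from the box to itself. *)
Lemma no_wrap (N G : nat) (p t : Z) :
  (1 <= p <= Z.of_nat N -> Z.abs (t - p) < Z.of_nat G ->
   1 <= t mod Z.of_nat (N + G) <= Z.of_nat N -> t mod Z.of_nat (N + G) = t)%Z.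
Proof.
  intros Hp Ht Hm.
  pose proof (Z.div_mod t (Z.of_nat (N + G)) ltac:(lia)) as E.
  set (w := (t / Z.of_nat (N + G))%Z) in *; set (v := (t mod Z.of_nat (N + G))%Z) in *.
  rewrite Nat2Z.inj_add in E.
  destruct (Z.lt_trichotomy w 0) as [? | [-> | ?]]; nia.
Qed.

Lemma gmod_in_box (N G : nat) (p t : GI) :
  in_box N p -> (Z.abs (gre t - gre p) < Z.of_nat G)%Z -> (Z.abs (gim t - gim p) < Z.of_nat G)%Z ->
  in_box N (gmod (N + G) t) -> gmod (N + G) t = t.
Proof.
  intros [H1 H2] H3 H4 [H5 H6]; apply GI_ext; cbn [gre gim gmod] in *;
    [apply (no_wrap N G (gre p)) | apply (no_wrap N G (gim p))]; assumption.
Qed.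

(** Since [g] has mean 0, the average of [(g + 2) * (g - t)] is the mean square minus [2 t], hence
    nonnegative. At a point where the product is nonnegative, [g + 2 > 0] forces [g >= t]. *)
Lemma one_sided_of_mean_square {X} (l : list X) (g : X -> R) (t : R) : l <> nil ->
  (forall x, -1 <= g x) -> avg l g = 0 -> 2 * t <= avg l (fun x => g x ^ 2) ->
  exists x, t <= g x.
Proof.
  intros Hl Hg H0 H.
  assert (K : 0 <= avg l (fun x => g x ^ 2 + ((2 - t) * g x + (- 2 * t)))).
  { rewrite !avg_add, avg_scale, avg_const, H0 by exact Hl; lra. }
  destruct (avg_exists l _ _ Hl K) as [x [_ Hx]]; exists x.
  specialize (Hg x); destruct (Rle_lt_dec t (g x)); nra.
Qed.

(** [dP] is the mass of [S0] divided by the area of the torus of side [N + G]. The gain is measured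
    against it; what the margin costs is settled in [increment_step] by taking [N] large compared
    with [G]. *)
Lemma density_increment (N G k L m : nat) (b : GI) (phi : GI -> GI) (S0 : GI -> R) (z : R) :
  let dP := avg (grid 1 N) S0 * (INR N / INR (N + G)) ^ 2 in
  let B := (Z.of_nat (fact (S m)) * Z.of_nat k ^ Z.of_nat m * gabs b)%Z in
  (1 <= N)%nat -> (1 <= k)%nat -> (1 <= L)%nat ->
  (forall x, S0 x = 0 \/ S0 x = 1) -> (forall x, S0 x = 1 -> in_box N x) ->
  poly_map (S m) b phi -> b <> gzero ->
  (forall n, In n (sumbox k L m) ->
     (Z.abs (gre (phi n)) < Z.of_nat G /\ Z.abs (gim (phi n)) < Z.of_nat G)%Z /\
     forall x, S0 x = 1 -> S0 (gadd x (phi n)) = 1 -> False) ->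
  (B * Z.of_nat L < Z.of_nat G)%Z ->
  0 < z <= 1 -> / INR k <= z ^ (2 ^ S m) -> 2 * z <= dP ^ 2 ->
  exists c x, c <> gzero /\ (gabs c <= B)%Z /\
    dP + z ^ (2 ^ S m) <= avg (grid 1 L) (fun y => S0 (gadd x (gmul c y))).
Proof.
  intros dP B HN Hk HL HS HSbox Hphi Hb Hn HB Hz Hkz HzP.
  assert (HG : G <> O).
  { intros ->; assert (0 <= B * Z.of_nat L)%Z; [| lia].
    unfold B; pose proof (gabs_nonneg b).
    repeat apply Z.mul_nonneg_nonneg; try lia; apply Z.pow_nonneg; lia. }
  set (P := (N + G)%nat).
  assert (HP : (1 <= P)%nat) by (unfold P; lia).
  assert (HT := grid_neq_nil 0 P HP).
  set (F := fun x => S0 (gmod P x)).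
  assert (HS01 : forall x, 0 <= S0 x <= 1) by (intro x; destruct (HS x) as [-> | ->]; lra).
  assert (HFper : periodic P F).
  { intro x; unfold F; f_equal.
    pose proof (gmod_gadd_l P x gzero HP) as E.
    replace (gadd (gmod P x) gzero) with (gmod P x) in E by ring.
    replace (gadd x gzero) with x in E by ring; exact E. }
  set (dF := avg (grid 0 P) F).
  assert (HdP0 : 0 <= dP).
  { apply Rmult_le_pos; [apply avg_nonneg; intros; apply HS01 | apply pow2_ge_0]. }
  assert (HdF1 : dF <= 1) by (apply avg_le_1; auto; intro; apply HS01).
  assert (HdPF : dP <= dF).
  { unfold dP, dF, avg; rewrite !length_grid.
    assert (0 < INR N) by (apply lt_0_INR; lia).
    assert (0 < INR P) by (apply lt_0_INR; lia).
    rewrite !mult_INR; fold P.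
    replace (lsum (grid 1 N) S0 / (INR N * INR N) * (INR N / INR P) ^ 2)
      with (lsum (grid 1 N) S0 / (INR P * INR P)) by (field; lra).
    apply Rmult_le_compat_r; [left; apply Rinv_0_lt_compat; nra |].
    rewrite (lsum_ext (grid 1 N) S0 F).
    - apply lsum_incl; [apply NoDup_grid | | intro; apply HS01].
      intros x Hx; apply in_grid in Hx; apply in_grid; unfold P; lia.
    - intros x Hx; unfold F; f_equal; apply in_grid in Hx.
      unfold P; apply GI_ext; cbn [gre gim gmod]; rewrite Z.mod_small; lia. }
  (* The constant is written as a multiple of 1 so that additivity and homogeneity of [avg] apply
     directly. *)
  set (f := fun x => F x + - dF * 1).
  assert (Hfper : periodic P f) by (intro x; unfold f; now rewrite HFper).
  assert (Hf1 : forall x, Rabs (f x) <= 1).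
  { intro x; unfold f; apply Rabs_le; pose proof (HS01 (gmod P x)); unfold F; lra. }
  (* If both factors were 1, the two reductions would lie in the box; as [phi n] is smaller than the
     margin, no wrapping occurs and they would differ by exactly [phi n]. *)
  assert (HFF : forall x n, In n (sumbox k L m) -> F x * F (gadd x (phi n)) = 0).
  { intros x n Hin; destruct (Hn n Hin) as [[Hr Hi] Hno].
    unfold F; destruct (HS (gmod P x)) as [-> | Hx]; [ring |].
    destruct (HS (gmod P (gadd x (phi n)))) as [-> | Hx']; [ring | exfalso].
    rewrite <- (gmod_gadd_l P x (phi n) HP) in Hx'.
    rewrite (gmod_in_box N G (gmod P x)) in Hx'; auto.
    - apply (Hno _ Hx Hx').
    - cbn [gre gadd]; replace (_ + _ - _)%Z with (gre (phi n)) by ring; exact Hr.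
    - cbn [gim gadd]; replace (_ + _ - _)%Z with (gim (phi n)) by ring; exact Hi. }
  assert (HW : avg (grid 0 P) (fun x => F x * avg (sumbox k L m) (fun n => f (gadd x (phi n))))
               = - dF ^ 2).
  { rewrite (avg_ext _ _ (fun x => - dF * F x)).
    - rewrite avg_scale; fold dF; ring.
    - intros x _; unfold f; rewrite avg_add, avg_scale, avg_const by (now apply sumbox_neq_nil).
      assert (E : F x * avg (sumbox k L m) (fun n => F (gadd x (phi n))) = 0).
      { rewrite <- avg_scale, (avg_ext _ _ (fun _ => 0)) by (intros; now apply HFF).
        apply avg_const; now apply sumbox_neq_nil. }
      rewrite Rmult_plus_distr_l, E; ring. }
  destruct (weyl_differencing P k L m b phi f F z) as [c [Hc [Hcb Hcf]]]; auto.
  { intro x; apply Rabs_le; pose proof (HS01 (gmod P x)); unfold F; lra. }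
  { rewrite HW, Rabs_Ropp, Rabs_pos_eq by apply pow2_ge_0; nra. }
  destruct (one_sided_of_mean_square (grid 0 P)
     (fun x => avg (grid 1 L) (fun y => f (gadd x (gmul c y)))) (z ^ (2 ^ S m)))
    as [x Hx]; auto.
  { intro x; assert (K : Rabs (avg (grid 1 L) (fun y => f (gadd x (gmul c y)))) <= 1)
      by (apply Rabs_avg_le; auto; now apply grid_neq_nil).
    apply Rabs_le_inv in K; lra. }
  { rewrite avg_swap, (avg_ext _ _ (fun _ => 0)); [now apply avg_const, grid_neq_nil |].
    intros y _; rewrite avg_translate by auto.
    unfold f; rewrite avg_add, avg_scale, avg_const by auto; fold dF; ring. }
  assert (HxF : dP + z ^ (2 ^ S m) <= avg (grid 1 L) (fun y => F (gadd x (gmul c y)))).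
  { unfold f in Hx; rewrite avg_add, avg_scale, avg_const in Hx by (now apply grid_neq_nil).
    lra. }
  assert (Hzp : 0 < z ^ (2 ^ S m)) by (apply pow_lt; lra).
  destruct (avg_exists (grid 1 L) _ _ (grid_neq_nil 1 L HL) HxF) as [y0 [Hy0 HFy0]].
  assert (Hp : S0 (gmod P (gadd x (gmul c y0))) = 1).
  { destruct (HS (gmod P (gadd x (gmul c y0)))) as [E | E]; [| exact E].
    unfold F in HFy0; rewrite E in HFy0; lra. }
  set (p := gmod P (gadd x (gmul c y0))) in *.
  (* The torus progression is anchored at [p], one of its points in the box. Every other point of it
     in [S0] reduces from [p + c (y - y0)], whose displacement from [p] is below [G], so it lies on
     the genuine progression. *)
  exists c, (gsub p (gmul c y0)); split; [exact Hc | split; [exact Hcb |]].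
  eapply Rle_trans; [exact HxF |]; apply avg_le; intros y Hy.
  unfold F; destruct (HS (gmod P (gadd x (gmul c y)))) as [-> | E]; [apply HS01 |].
  rewrite E; right.
  assert (E' : gmod P (gadd x (gmul c y)) = gmod P (gadd (gsub p (gmul c y0)) (gmul c y))).
  { replace (gadd x (gmul c y)) with (gadd (gadd x (gmul c y0)) (gsub (gmul c y) (gmul c y0))) by ring.
    rewrite <- gmod_gadd_l by auto; fold p; f_equal; ring. }
  rewrite E' in E.
  replace (gadd (gsub p (gmul c y0)) (gmul c y)) with (gadd p (gmul c (gsub y y0))) in * by ring.
  (* Bounding the coordinates separately gives [gabs c * L]; the l1 bound on [y - y0] would cost a
     further factor 2. *)
  assert (Hcy : (Z.abs (gre (gmul c (gsub y y0))) < Z.of_nat G /\ Z.abs (gim (gmul c (gsub y y0))) < Z.of_nat G)%Z).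
  { apply in_grid in Hy, Hy0; unfold gabs in Hcb; cbn [gre gim gmul gsub].
    set (y1 := (gre y - gre y0)%Z) in *; set (y2 := (gim y - gim y0)%Z) in *.
    assert (Hy1 : (Z.abs y1 <= Z.of_nat L)%Z) by lia.
    assert (Hy2 : (Z.abs y2 <= Z.of_nat L)%Z) by lia.
    assert (Hm : forall a y, (Z.abs y <= Z.of_nat L -> Z.abs (a * y) <= Z.abs a * Z.of_nat L)%Z)
      by (intros; rewrite Z.abs_mul; apply Z.mul_le_mono_nonneg_l; lia).
    pose proof (Hm (gre c) y1 Hy1); pose proof (Hm (gre c) y2 Hy2);
    pose proof (Hm (gim c) y1 Hy1); pose proof (Hm (gim c) y2 Hy2).
    assert (Hcc : ((Z.abs (gre c) + Z.abs (gim c)) * Z.of_nat L <= B * Z.of_nat L)%Z)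
      by (apply Z.mul_le_mono_nonneg_r; [lia | exact Hcb]).
    rewrite Z.mul_add_distr_r in Hcc.
    clear - H H0 H1 H2 Hcc HB; lia. }
  destruct Hcy as [Hcy1 Hcy2].
  rewrite (gmod_in_box N G p) in E; auto.
  - cbn [gre gadd]; replace (_ + _ - _)%Z with (gre (gmul c (gsub y y0))) by ring; exact Hcy1.
  - cbn [gim gadd]; replace (_ + _ - _)%Z with (gim (gmul c (gsub y y0))) by ring; exact Hcy2.
Qed.

(** * Exact division and roots of [q] modulo [D] *)

Definition gquo (w D : GI) : GI :=
  mkGI (gre (gmul w (gconj D)) / gnorm D) (gim (gmul w (gconj D)) / gnorm D).

(** Multiplying by the conjugate turns division by [D] into coordinatewise division by [gnorm D],
    which is exact on multiples of [D]. *)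
Lemma gmul_gquo (w D : GI) : D <> gzero -> gdvd D w -> gmul D (gquo w D) = w.
Proof.
  intros HD [y ->]; f_equal; pose proof (gnorm_ge1 D HD).
  apply GI_ext; unfold gquo; cbn [gre gim];
    replace (gmul (gmul D y) (gconj D)) with (gmul y (gofZ (gnorm D)))
      by (rewrite <- gmul_gconj; ring); cbn [gre gim gmul gofZ].
  - replace (_ - _)%Z with (gre y * gnorm D)%Z by ring; apply Z.div_mul; lia.
  - replace (_ + _)%Z with (gim y * gnorm D)%Z by ring; apply Z.div_mul; lia.
Qed.

Lemma gdvd_gadd (D x y : GI) : gdvd D x -> gdvd D y -> gdvd D (gadd x y).
Proof. intros [u ->] [v ->]; exists (gadd u v); ring. Qed.

(* Translating a root of [q] mod [D] far out in the direction [D] makes [q] nonvanishing at all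
   the points that are sampled. *)
Lemma intersective_quotient (q : gpoly) (m : nat) : has_degree q (S m) -> intersective q ->
  exists B : nat, forall (D : GI) (X k L : nat), D <> gzero -> (gabs D <= Z.of_nat X)%Z ->
    (1 <= k)%nat -> (1 <= L)%nat ->
    exists r g, (forall n, gmul D (g n) = peval q (gadd r (gmul D n))) /\
      forall n, In n (sumbox k L m) -> peval q (gadd r (gmul D n)) <> gzero /\
        (gabs (peval q (gadd r (gmul D n))) <= Z.of_nat (B * (X ^ 3 * k * L) ^ S m))%Z.
Proof.
  intros Hq Hint; destruct (peval_nonzero_outside q (S m) Hq) as [R0 [HR0 Hnz]].
  (* [E] counts multiples of [X^3 k L] in the bound for the argument of [q]: [R0] and [m] from
     [R0 X] and [m X k], and 7 from [2 X^2] (the size of [r1]), [2 X^3], [X] and [2 X L]. *)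
  set (E := (R0 + Z.of_nat m + 7)%Z).
  exists (Z.to_nat (gcoef_sum q * E ^ Z.of_nat (S m))).
  intros D X k L HD HX Hk HL.
  destruct (Hint D HD) as [r0 Hr0].
  pose proof (gnorm_ge1 D HD) as Hnu; set (nu := gnorm D) in *.
  (* The norm of [D] is a multiple of [D], so reducing the coordinates modulo it keeps a root modulo
     [D] and bounds its size in terms of [D]. *)
  set (r1 := mkGI (gre r0 mod nu) (gim r0 mod nu)).
  (* Since [gabs r1 <= 2 * nu] and [D * (s + n)] has l1 size at least [s], this shift puts every
     sampled point beyond the radius [R0]. *)
  set (s := (R0 + 2 * nu + 1)%Z).
  set (r := gadd r1 (gmul D (gofZ s))).
  exists r, (fun n => gquo (peval q (gadd r (gmul D n))) D).
  assert (Hr1 : (0 <= gre r1 < nu /\ 0 <= gim r1 < nu)%Z)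
    by (split; apply Z.mod_pos_bound; lia).
  split.
  - intro n; apply gmul_gquo; [exact HD |].
    set (u := mkGI (gre r0 / nu) (gim r0 / nu)).
    assert (Er : r0 = gadd r1 (gmul (gofZ nu) u)).
    { pose proof (Z.div_mod (gre r0) nu ltac:(lia)); pose proof (Z.div_mod (gim r0) nu ltac:(lia)).
      apply GI_ext; unfold r1, u; cbn [gre gim gadd gmul gofZ]; lia. }
    unfold nu in Er; rewrite <- gmul_gconj in Er.
    replace (gadd r (gmul D n))
      with (gadd r0 (gmul D (gsub (gadd (gofZ s) n) (gmul (gconj D) u))))
      by (rewrite Er; unfold r; ring).
    set (w := gsub _ _).
    replace (peval q (gadd r0 (gmul D w)))
      with (gadd (gsub (peval q (gadd r0 (gmul D w))) (peval q r0)) (peval q r0)) by ring.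
    apply gdvd_gadd; [apply gdvd_peval_shift | exact Hr0].
  - intros n Hn; destruct (in_sumbox _ _ _ _ Hn) as [Hn1 Hn2].
    assert (Ez : gadd r (gmul D n) = gadd r1 (gmul D (gadd (gofZ s) n))) by (unfold r; ring).
    rewrite Ez; set (v := gadd (gofZ s) n) in *.
    assert (Hr1a : (gabs r1 <= 2 * nu)%Z) by (unfold gabs; lia).
    split.
    + apply Hnz; apply Z.nle_gt; intro Hle.
      assert (H1 : (gabs (gmul D v) <= R0 + 2 * nu)%Z).
      { replace (gmul D v) with (gsub (gadd r1 (gmul D v)) r1) by ring.
        eapply Z.le_trans; [apply gabs_gsub |]; lia. }
      pose proof (gnorm_le_gabs_sqr (gmul D v)) as H2.
      pose proof (gabs_nonneg (gmul D v)) as H3.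
      rewrite gnorm_gmul in H2; fold nu in H2.
      assert (H4 : (s * s <= gnorm v)%Z).
      { unfold gnorm, v; cbn [gre gim gadd gofZ]; unfold s in *; nia. }
      assert (H5 : (gabs (gmul D v) * gabs (gmul D v) < s * s)%Z).
      { apply Z.square_lt_mono_nonneg; unfold s; lia. }
      assert (1 * gnorm v <= nu * gnorm v)%Z
        by (apply Z.mul_le_mono_nonneg_r; [apply gnorm_nonneg | lia]).
      lia.
    + assert (HX1 : (1 <= Z.of_nat X)%Z) by (pose proof (gabs_ge1 D HD); lia).
      assert (Hnu2 : (nu <= Z.of_nat X * Z.of_nat X)%Z).
      { eapply Z.le_trans; [apply gnorm_le_gabs_sqr |].
        pose proof (gabs_nonneg D); apply Z.mul_le_mono_nonneg; lia. }
      set (Q := Z.of_nat (X ^ 3 * k * L)).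
      assert (HQ : Q = (Z.of_nat X * Z.of_nat X * Z.of_nat X * Z.of_nat k * Z.of_nat L)%Z)
        by (unfold Q; simpl; lia).
      set (x := Z.of_nat X) in *; set (k' := Z.of_nat k) in *; set (l := Z.of_nat L) in *.
      assert (Hk' : (1 <= k')%Z) by lia; assert (Hl : (1 <= l)%Z) by lia.
      assert (HE : (1 <= E)%Z) by lia.
      set (t := (x * x * x)%Z) in *.
      assert (Hx2 : (x * x <= t)%Z) by (unfold t; nia).
      assert (Hx1 : (x <= x * x)%Z) by nia.
      assert (Htk : (t <= t * k')%Z) by nia.
      assert (HtQ : (t * k' <= Q)%Z) by nia.
      assert (HkQ : (x * k' <= Q)%Z).
      { assert (x * k' <= t * k')%Z by (apply Z.mul_le_mono_nonneg_r; lia); lia. }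
      assert (HlQ : (x * l <= Q)%Z).
      { rewrite HQ; apply Z.mul_le_mono_nonneg_r; lia. }
      assert (HQ1 : (1 <= Q)%Z) by lia.
      assert (Hz : (gabs (gadd r1 (gmul D v)) <= E * Q)%Z).
      { eapply Z.le_trans; [apply gabs_gadd |].
        pose proof (gabs_gmul D v) as H1.
        pose proof (gabs_gadd (gofZ s) n) as H2; fold v in H2; rewrite gabs_gofZ in H2.
        assert (H3 : (gabs v <= R0 + 2 * (x * x) + 1 + Z.of_nat m * k' + 2 * l)%Z)
          by (unfold s in H2; lia).
        assert (H4 : (gabs D * gabs v <= x * (R0 + 2 * (x * x) + 1 + Z.of_nat m * k' + 2 * l))%Z).
        { pose proof (gabs_nonneg D); pose proof (gabs_nonneg v);
          apply Z.mul_le_mono_nonneg; lia. }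
        assert (H5 : (x * (R0 + 2 * (x * x) + 1 + Z.of_nat m * k' + 2 * l) =
                 R0 * x + 2 * t + x + Z.of_nat m * (x * k') + 2 * (x * l))%Z) by (unfold t; ring).
        assert (H6 : (R0 * x <= R0 * Q)%Z) by (apply Z.mul_le_mono_nonneg_l; lia).
        assert (H7 : (Z.of_nat m * (x * k') <= Z.of_nat m * Q)%Z) by (apply Z.mul_le_mono_nonneg_l; lia).
        unfold E; rewrite !Z.mul_add_distr_r; lia. }
      assert (HEQ : (1 <= E * Q)%Z) by nia.
      eapply Z.le_trans; [apply (gabs_peval q (S m) _ (E * Q) (proj1 Hq) HEQ Hz) |].
      rewrite Nat2Z.inj_mul, Nat2Z.inj_pow; fold Q.
      rewrite Z2Nat.id.
      * rewrite Z.pow_mul_l; lia.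
      * apply Z.mul_nonneg_nonneg; [apply gcoef_sum_nonneg | apply Z.pow_nonneg; lia].
Qed.

(** * One increment for a set avoiding the values of [q] *)

Definition indicator (A : list GI) (x : GI) : R := if in_dec GI_eq_dec x A then 1 else 0.

Definition density (A : list GI) (a D : GI) (N : nat) : R :=
  avg (grid 1 N) (fun y => indicator A (gadd a (gmul D y))).

Definition avoids (q : gpoly) (A : list GI) : Prop :=
  forall x y z, In x A -> In y A -> x <> y -> gsub x y <> peval q z.

Lemma indicator_bounds A x : 0 <= indicator A x <= 1.
Proof. unfold indicator; destruct (in_dec GI_eq_dec x A); lra. Qed.

Lemma density_le_1 A a D N : (1 <= N)%nat -> density A a D N <= 1.
Proof. intro; apply avg_le_1; [now apply grid_neq_nil | intro; apply indicator_bounds]. Qed.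

Lemma gabs_gpow (D : GI) (X : Z) (m : nat) : (gabs D <= X -> gabs (gpow D m) <= X ^ Z.of_nat m)%Z.
Proof.
  intro H; induction m as [| m IH]; [rewrite Z.pow_0_r; unfold gabs; simpl; lia |].
  rewrite Nat2Z.inj_succ, Z.pow_succ_r by lia; simpl gpow.
  eapply Z.le_trans; [apply gabs_gmul |].
  apply Z.mul_le_mono_nonneg; auto using gabs_nonneg.
Qed.

Lemma gpow_neq0 (D : GI) (m : nat) : D <> gzero -> gpow D m <> gzero.
Proof. intro H; induction m as [| m IH]; [discriminate | now apply gmul_neq0]. Qed.

(** The gain [eta] depends on the fixed lower bound [d0] and not on the current density, so it is
    the same at every iteration. Half of it pays for embedding the box in a larger torus. *)
Lemma increment_step (q : gpoly) (m : nat) : has_degree q (S m) -> intersective q ->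
  exists B : nat, (1 <= B)%nat /\
  forall (A : list GI) (d0 : R) (k : nat) (a D : GI) (N L X : nat),
    let eta := (d0 ^ 2 / 8) ^ (2 ^ S m) in
    avoids q A -> 0 < d0 <= 1 -> (1 <= k)%nat -> / INR k <= eta ->
    D <> gzero -> (gabs D <= Z.of_nat X)%Z -> (1 <= L)%nat ->
    (4 * B * k * (X ^ 3 * k * L) ^ S m <= N)%nat ->
    d0 <= density A a D N ->
    exists a' D', D' <> gzero /\ (gabs D' <= Z.of_nat (B * X ^ S m * k ^ S m))%Z /\
      density A a D N + eta / 2 <= density A a' D' L.
Proof.
  intros Hq Hint.
  destruct (intersective_quotient q m Hq Hint) as [B0 HB0].
  set (lead := last q gzero).
  (* [B0] lets [G] dominate the values of [q], the factorial term lets it dominate the displacements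
     [c * y], and the added 1 makes both inequalities strict. *)
  exists (B0 + fact (S m) * Z.to_nat (gabs lead) + 1)%nat; split; [lia |].
  set (B := (B0 + fact (S m) * Z.to_nat (gabs lead) + 1)%nat).
  intros A d0 k a D N L X eta HA Hd0 Hk Hketa HD HX HL HN Hdens.
  destruct (HB0 D X k L HD HX Hk HL) as [r [g [Hg Hgn]]].
  set (Q := (X ^ 3 * k * L)%nat) in *; set (G := (B * Q ^ S m)%nat).
  assert (HX1 : (1 <= X)%nat) by (pose proof (gabs_ge1 D HD); lia).
  assert (HkXQ : (k * X <= Q)%nat).
  { replace Q with (k * X * (X * X * L))%nat by (unfold Q; simpl; ring).
    rewrite <- (Nat.mul_1_r (k * X)) at 1; apply Nat.mul_le_mono_l; nia. }
  assert (HLQ : (L <= Q)%nat).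
  { unfold Q; assert (1 <= X ^ 3 * k)%nat by (pose proof (Nat.pow_nonzero X 3); nia); nia. }
  assert (HQ1 : (1 <= Q ^ S m)%nat)
    by (assert (Q ^ S m <> 0)%nat by (apply Nat.pow_nonzero; lia); lia).
  assert (HG1 : (1 <= G)%nat) by (unfold G, B; nia).
  assert (HGN : (4 * G * k <= N)%nat) by (unfold G; nia).
  assert (HN1 : (1 <= N)%nat) by nia.
  (* The map [q(r + D n)] has leading coefficient [lead * D^(m+1)]; division by [D] leaves this
     one. *)
  set (b := gmul lead (gpow D m)).
  assert (Hb0 : b <> gzero) by (apply gmul_neq0; [apply Hq | now apply gpow_neq0]).
  assert (Hbabs : (gabs b <= gabs lead * Z.of_nat X ^ Z.of_nat m)%Z).
  { eapply Z.le_trans; [apply gabs_gmul |].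
    apply Z.mul_le_mono_nonneg_l; [apply gabs_nonneg | now apply gabs_gpow]. }
  assert (Hpoly : poly_map (S m) b g).
  { apply (poly_map_scale_inv _ D); [exact HD |].
    pose proof (poly_map_dilate _ _ D _ (poly_map_shift _ _ r _ (poly_map_peval q (S m) (proj1 Hq)))) as K.
    eapply poly_map_ext; [| | exact K].
    - unfold b; fold lead; simpl gpow; ring.
    - intro n; rewrite Hg; reflexivity. }
  set (S0 := fun x => if in_dec GI_eq_dec x (grid 1 N) then indicator A (gadd a (gmul D x)) else 0).
  assert (HS0 : forall x, S0 x <= indicator A (gadd a (gmul D x))).
  { intro x; unfold S0; destruct in_dec; [lra | apply indicator_bounds]. }
  assert (HS1 : forall x, S0 x = 1 -> in_box N x /\ In (gadd a (gmul D x)) A).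
  { intro x; unfold S0, indicator; destruct in_dec as [Hx | Hx]; [| lra].
    destruct in_dec; [| lra]; intros _; split; auto.
    apply in_grid in Hx; unfold in_box; lia. }
  assert (Havg : avg (grid 1 N) S0 = density A a D N).
  { apply avg_ext; intros x Hx; unfold S0; destruct in_dec; [reflexivity | contradiction]. }
  assert (HBc : (Z.of_nat (fact (S m)) * Z.of_nat k ^ Z.of_nat m * gabs b
                 <= Z.of_nat (B - 1) * (Z.of_nat k * Z.of_nat X) ^ Z.of_nat m)%Z).
  { rewrite Z.pow_mul_l.
    apply Z.le_trans with (Z.of_nat (fact (S m)) * Z.of_nat k ^ Z.of_nat m *
                           (gabs lead * Z.of_nat X ^ Z.of_nat m))%Z.
    - apply Z.mul_le_mono_nonneg_l; [| exact Hbabs].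
      apply Z.mul_nonneg_nonneg; [lia | apply Z.pow_nonneg; lia].
    - replace (_ * _ * (_ * _))%Z with (Z.of_nat (fact (S m)) * gabs lead *
         (Z.of_nat k ^ Z.of_nat m * Z.of_nat X ^ Z.of_nat m))%Z by ring.
      apply Z.mul_le_mono_nonneg_r;
        [apply Z.mul_nonneg_nonneg; apply Z.pow_nonneg; lia |].
      unfold B; pose proof (gabs_nonneg lead); rewrite Nat2Z.inj_sub by lia.
      rewrite !Nat2Z.inj_add, Nat2Z.inj_mul, Z2Nat.id by lia; lia. }
  assert (HGlt : (Z.of_nat (fact (S m)) * Z.of_nat k ^ Z.of_nat m * gabs b * Z.of_nat L < Z.of_nat G)%Z).
  { apply Z.le_lt_trans with (Z.of_nat (B - 1) * (Z.of_nat k * Z.of_nat X) ^ Z.of_nat m * Z.of_nat L)%Z;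
      [apply Z.mul_le_mono_nonneg_r; [lia | exact HBc] |].
    rewrite <- !Nat2Z.inj_mul, <- Nat2Z.inj_pow, <- !Nat2Z.inj_mul.
    apply Nat2Z.inj_lt; unfold G.
    assert (H1 : ((k * X) ^ m * L <= Q ^ S m)%nat).
    { rewrite Nat.pow_succ_r', Nat.mul_comm; apply Nat.mul_le_mono; [exact HLQ |].
      apply Nat.pow_le_mono_l; exact HkXQ. }
    assert (1 <= B)%nat by (unfold B; lia).
    rewrite <- Nat.mul_assoc; nia. }
  (* The density on the torus is still at least [d0 / 2], and [2 * z = (d0 / 2)^2], which is the
     correlation required. *)
  set (z := d0 ^ 2 / 8) in *.
  assert (Hz : 0 < z <= 1) by (unfold z; simpl; nra).
  assert (Heta : eta <= z) by (apply pow_le_self; [lra | apply Nat.pow_nonzero; lia]).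
  assert (Heta0 : 0 < eta) by (apply pow_lt; lra).
  set (rho := INR N / INR (N + G)).
  (* From [4 G k <= N] and [1/k <= eta], the margin takes a proportion at most [eta / 4] of the
     side, hence at most [eta / 2] of the area. *)
  assert (Hrho : 1 - eta / 4 <= rho <= 1).
  { assert (HNr : 0 < INR N) by (apply lt_0_INR; lia).
    assert (HGr : 0 < INR G) by (apply lt_0_INR; lia).
    assert (Hkr : 0 < INR k) by (apply lt_0_INR; lia).
    assert (E : rho = 1 - INR G / (INR N + INR G)) by (unfold rho; rewrite plus_INR; field; lra).
    assert (H1 : 0 < INR G / (INR N + INR G)) by (apply Rdiv_lt_0_compat; lra).
    assert (H2 : INR G / (INR N + INR G) <= / INR k / 4).
    { apply le_INR in HGN; rewrite !mult_INR in HGN; simpl (INR 4) in HGN.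
      apply Rmult_le_reg_r with ((INR N + INR G) * INR k * 4); [nra |].
      replace (INR G / (INR N + INR G) * ((INR N + INR G) * INR k * 4))
        with (4 * INR G * INR k) by (field; lra).
      replace (/ INR k / 4 * ((INR N + INR G) * INR k * 4))
        with (INR N + INR G) by (field; lra).
      lra. }
    lra. }
  pose proof (density_le_1 A a D N HN1) as Hd1.
  set (d1 := density A a D N) in *.
  assert (HdP : d1 - eta / 2 <= d1 * rho ^ 2).
  { assert (1 - eta / 2 <= rho ^ 2) by (simpl; nra).
    assert (d1 * (1 - eta / 2) <= d1 * rho ^ 2) by (apply Rmult_le_compat_l; lra).
    nra. }
  destruct (density_increment N G k L m b g S0 z) as [c [x [Hc [Hcb Hcx]]]]; auto.
  - intro x; unfold S0, indicator; destruct in_dec; [destruct in_dec |]; auto.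
  - intros x Hx; apply (HS1 x Hx).
  - intros n Hn; destruct (Hgn n Hn) as [Hnz Hgb]; split.
    + assert (Hlt : (gabs (peval q (gadd r (gmul D n))) < Z.of_nat G)%Z).
      { eapply Z.le_lt_trans; [exact Hgb |]; apply Nat2Z.inj_lt.
        apply Nat.mul_lt_mono_pos_r; unfold B; lia. }
      set (w := gabs (peval q (gadd r (gmul D n)))) in *.
      pose proof (gabs_nonneg (peval q (gadd r (gmul D n)))) as Hw; fold w in Hw.
      assert (Hgw : (gnorm (g n) <= w * w)%Z).
      { pose proof (gnorm_le_gabs_sqr (peval q (gadd r (gmul D n)))) as H1; fold w in H1.
        rewrite <- Hg, gnorm_gmul in H1.
        pose proof (gnorm_ge1 D HD); pose proof (gnorm_nonneg (g n)); nia. }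
      destruct (coord_le_of_gnorm _ _ Hw Hgw); lia.
    (* [avoids] concerns distinct elements, and distinctness here comes from the nonvanishing of [q]
       at the sampled points. *)
    + intros y Hy Hy'; destruct (HS1 _ Hy) as [_ H1]; destruct (HS1 _ Hy') as [_ H2].
      assert (E : gsub (gadd a (gmul D (gadd y (g n)))) (gadd a (gmul D y))
                  = peval q (gadd r (gmul D n))) by (rewrite <- Hg; ring).
      apply (HA _ _ (gadd r (gmul D n)) H2 H1); [| exact E].
      intro E'; rewrite E' in E; apply Hnz; rewrite <- E; ring.
  - rewrite Havg; fold d1; fold rho.
    assert (d0 / 2 <= d1 * rho ^ 2) by (unfold z in *; nra).
    unfold z; nra.
  - rewrite Havg in Hcx; fold d1 rho eta in Hcx.
    exists (gadd a (gmul D x)), (gmul D c); split; [now apply gmul_neq0 | split].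
    + eapply Z.le_trans; [apply gabs_gmul |].
      apply Z.le_trans with (Z.of_nat X * (Z.of_nat (B - 1) * (Z.of_nat k * Z.of_nat X) ^ Z.of_nat m))%Z.
      { pose proof (gabs_nonneg D); pose proof (gabs_nonneg c).
        apply Z.mul_le_mono_nonneg; lia. }
      rewrite <- !Nat2Z.inj_mul, <- Nat2Z.inj_pow, <- !Nat2Z.inj_mul.
      apply Nat2Z.inj_le; fold B; rewrite Nat.pow_mul_l, !Nat.pow_succ_r'.
      assert (1 <= k ^ m)%nat by (assert (k ^ m <> 0)%nat by (apply Nat.pow_nonzero; lia); lia).
      assert (1 <= X ^ m)%nat by (assert (X ^ m <> 0)%nat by (apply Nat.pow_nonzero; lia); lia).
      set (e1 := (k ^ m)%nat) in *; set (e2 := (X ^ m)%nat) in *.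
      replace (X * ((B - 1) * (e1 * e2)))%nat with ((B - 1) * (X * e2) * (1 * e1))%nat by ring.
      apply Nat.mul_le_mono; [apply Nat.mul_le_mono_r; lia | apply Nat.mul_le_mono_r; lia].
    + eapply Rle_trans with (avg (grid 1 L) (fun y => S0 (gadd x (gmul c y)))); [lra |].
      apply avg_le; intros y _; eapply Rle_trans; [apply HS0 |].
      right; f_equal; ring.
Qed.

(** * Iteration *)

(** With [Y = C X], one has [X^3 k <= Y^3] and [C * (B X^d k^d) <= Y^(d+2)], so the left side is at
    most [Y] to the power [1 + (3 + (d + 2) E) d]. As [E >= 1], this exponent is at most
    [(d^2 + 5 d + 1) E]: a step back multiplies the exponent by a constant. *)
Lemma iteration_threshold (B k X d E : nat) : (1 <= B)%nat -> (1 <= k)%nat -> (1 <= X)%nat ->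
  (1 <= E)%nat ->
  let C := (4 * B * k)%nat in
  (C * (X ^ 3 * k * (C * (B * X ^ d * k ^ d)) ^ E) ^ d
     <= (C * X) ^ ((d * d + 5 * d + 1) * E))%nat.
Proof.
  intros HB Hk HX HE C; set (Y := (C * X)%nat).
  assert (HC : (1 <= C)%nat) by (unfold C; nia).
  assert (HY : (1 <= Y)%nat) by (unfold Y; nia).
  assert (HCY : (C <= Y)%nat) by (unfold Y; nia).
  assert (HBY : (B <= Y)%nat) by (unfold C in HCY; nia).
  assert (HkC : (k <= C)%nat) by (unfold C; nia).
  assert (HXkY : (X * k <= Y)%nat) by (unfold Y; nia).
  assert (H1 : (C * (B * X ^ d * k ^ d) <= Y ^ (d + 2))%nat).
  { rewrite <- Nat.mul_assoc, <- Nat.pow_mul_l.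
    replace (Y ^ (d + 2))%nat with (Y * (Y * Y ^ d))%nat
      by (rewrite Nat.pow_add_r; simpl; ring).
    apply Nat.mul_le_mono; [exact HCY |]; apply Nat.mul_le_mono; [exact HBY |].
    apply Nat.pow_le_mono_l; exact HXkY. }
  assert (H2 : (X ^ 3 * k <= Y ^ 3)%nat).
  { unfold Y; rewrite Nat.pow_mul_l, Nat.mul_comm; apply Nat.mul_le_mono_r.
    eapply Nat.le_trans; [exact HkC |].
    rewrite <- (Nat.pow_1_r C) at 1; apply Nat.pow_le_mono_r; lia. }
  apply Nat.le_trans with (Y ^ 1 * (Y ^ 3 * (Y ^ (d + 2)) ^ E) ^ d)%nat.
  - rewrite Nat.pow_1_r; apply Nat.mul_le_mono; [exact HCY |].
    apply Nat.pow_le_mono_l, Nat.mul_le_mono; [exact H2 |].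
    apply Nat.pow_le_mono_l; exact H1.
  - rewrite <- Nat.pow_mul_r, <- Nat.pow_add_r, <- Nat.pow_mul_r, <- Nat.pow_add_r.
    apply Nat.pow_le_mono_r; [lia | nia].
Qed.

(** A box large enough for [j] increments has density at least [j * eta / 2] below 1, because each
    increment stays within the trivial bound. The density never drops below [d0], so the same [eta]
    serves throughout. *)
Lemma density_bounded_by_steps (q : gpoly) (m : nat) : has_degree q (S m) -> intersective q ->
  exists B : nat, (1 <= B)%nat /\
  forall (A : list GI) (d0 : R) (k : nat),
    let eta := (d0 ^ 2 / 8) ^ (2 ^ S m) in
    avoids q A -> 0 < d0 <= 1 -> (1 <= k)%nat -> / INR k <= eta ->
    forall (j : nat) (a D : GI) (N X : nat), D <> gzero -> (gabs D <= Z.of_nat X)%Z ->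
    ((4 * B * k * X) ^ ((S m * S m + 5 * S m + 1) ^ j) <= N)%nat ->
    d0 <= density A a D N -> density A a D N <= 1 - INR j * (eta / 2).
Proof.
  intros Hq Hint; destruct (increment_step q m Hq Hint) as [B [HB Hstep]].
  exists B; split; [exact HB |].
  intros A d0 k eta HA Hd0 Hk Hketa j.
  set (F := (S m * S m + 5 * S m + 1)%nat).
  assert (Heta : 0 < eta) by (apply pow_lt; simpl; nra).
  induction j as [| j IH]; intros a D N X HD HX HN Hd;
    assert (HX1 : (1 <= X)%nat) by (pose proof (gabs_ge1 D HD); lia).
  - rewrite Nat.pow_0_r, Nat.pow_1_r in HN; simpl INR; rewrite Rmult_0_l, Rminus_0_r.
    apply density_le_1; nia.
  - set (X' := (B * X ^ S m * k ^ S m)%nat).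
    (* The new side is exactly the threshold demanded by the induction hypothesis for the new
       dilation bound [X']. *)
    set (L := ((4 * B * k * X') ^ (F ^ j))%nat).
    assert (HF : (1 <= F ^ j)%nat)
      by (assert (F ^ j <> 0)%nat by (apply Nat.pow_nonzero; unfold F; lia); lia).
    assert (HX' : (1 <= X')%nat).
    { assert (X ^ S m <> 0)%nat by (apply Nat.pow_nonzero; lia).
      assert (k ^ S m <> 0)%nat by (apply Nat.pow_nonzero; lia).
      apply Nat.mul_pos_pos; [apply Nat.mul_pos_pos |]; lia. }
    assert (HL : (1 <= L)%nat).
    { assert (4 * B * k * X' <> 0)%nat by nia.
      assert (L <> 0)%nat by (apply Nat.pow_nonzero; assumption); lia. }
    destruct (Hstep A d0 k a D N L X) as [a' [D' [HD' [HX'' Hd']]]]; auto.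
    + eapply Nat.le_trans; [| exact HN].
      rewrite (Nat.pow_succ_r' F j).
      exact (iteration_threshold B k X (S m) (F ^ j) HB Hk HX1 HF).
    + fold eta X' in HX'', Hd'.
      assert (density A a' D' L <= 1 - INR j * (eta / 2)).
      { apply (IH a' D' L X'); auto; lra. }
      rewrite S_INR; lra.
Qed.

Lemma length_le_density (A : list GI) (N : nat) :
  (1 <= N)%nat -> NoDup A -> (forall x, In x A -> in_box N x) ->
  INR (length A) / INR (N * N) <= density A gzero gone N.
Proof.
  intros HN HA Hbox; unfold density, avg; rewrite length_grid.
  apply Rmult_le_compat_r; [left; apply Rinv_0_lt_compat, lt_0_INR; nia |].
  rewrite (lsum_ext _ _ (indicator A)) by (intros; f_equal; ring).
  apply Rle_trans with (lsum A (indicator A)).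
  - rewrite (lsum_ext A _ (fun _ => 1)), lsum_const; [lra |].
    intros x Hx; unfold indicator; destruct in_dec; [reflexivity | contradiction].
  - apply lsum_incl; auto; [| intro; apply indicator_bounds].
    intros x Hx; apply in_grid; destruct (Hbox x Hx); lia.
Qed.

(** * From the tower of height two to the double logarithm *)

Lemma exists_nat_inv_le (eta : R) : 0 < eta <= 1 ->
  exists k : nat, (1 <= k)%nat /\ / INR k <= eta /\ INR k <= 2 / eta.
Proof.
  intros He; assert (H1 : 1 <= / eta) by (rewrite <- Rinv_1; apply Rinv_le_contravar; lra).
  destruct (archimed (/ eta)) as [Ha Hb].
  assert (Hup : (1 <= up (/ eta))%Z) by (assert (0 < up (/ eta))%Z by (apply lt_IZR; lra); lia).
  exists (Z.to_nat (up (/ eta))).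
  assert (E : INR (Z.to_nat (up (/ eta))) = IZR (up (/ eta))) by (rewrite INR_IZR_INZ, Z2Nat.id; [reflexivity | lia]).
  rewrite E; split; [lia | split].
  - apply Rle_trans with (/ / eta); [apply Rinv_le_contravar | rewrite Rinv_inv]; lra.
  - unfold Rdiv; lra.
Qed.

(** From [exp (-1/6) >= 5/6] and [(5/6)^6 > 1/3]. It ensures that [ln (ln N)] is positive from
    [N = 3] on. *)
Lemma exp_1_lt_3 : exp 1 < 3.
Proof.
  pose proof (exp_ineq1 (- / 6) ltac:(lra)) as H.
  assert (E : exp (-1) = exp (- / 6) ^ 6).
  { simpl; rewrite Rmult_1_r, <- !exp_plus; f_equal; lra. }
  assert (K : (5 / 6) ^ 6 <= exp (- / 6) ^ 6) by (apply pow_incr; lra).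
  assert (E1 : exp 1 * exp (-1) = 1) by (rewrite <- exp_plus, Rplus_opp_r; apply exp_0).
  rewrite <- E in K; assert (/ 3 < exp (-1)) by (simpl in K; lra).
  pose proof (exp_pos 1); nra.
Qed.

Lemma ln_le_sub1 (x : R) : 0 < x -> ln x <= x - 1.
Proof.
  intro Hx; pose proof (exp_ineq1_le (ln x)) as H; rewrite exp_ln in H by exact Hx; lra.
Qed.

Lemma lnln_pos (N : nat) : (3 <= N)%nat -> 1 < ln (INR N) /\ 0 < ln (ln (INR N)).
Proof.
  intro H; apply le_INR in H; simpl (INR 3) in H.
  assert (H1 : 1 < ln (INR N)).
  { rewrite <- (ln_exp 1); apply ln_increasing; [apply exp_pos |]; pose proof exp_1_lt_3; lra. }
  split; [exact H1 |]; rewrite <- ln_1; apply ln_increasing; lra.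
Qed.

(** Two logarithms bring the tower down to [(2 k + 1) ln F + ln (ln C)] with [C = 4 B k]; then
    [ln x <= x - 1] makes this linear in [k]. *)
Lemma lnln_tower_bound (N B k F : nat) : (3 <= N)%nat -> (1 <= B)%nat -> (1 <= k)%nat ->
  (1 <= F)%nat -> (N < (4 * B * k) ^ (F ^ (2 * k + 1)))%nat ->
  ln (ln (INR N)) <= (3 * INR F + 4 * INR B) * INR k.
Proof.
  intros HN HB Hk HF H; destruct (lnln_pos N HN) as [H1 _].
  assert (HBr : 1 <= INR B) by (apply (le_INR 1); exact HB).
  assert (Hkr : 1 <= INR k) by (apply (le_INR 1); exact Hk).
  assert (HFr : 1 <= INR F) by (apply (le_INR 1); exact HF).
  set (C := 4 * INR B * INR k).
  assert (HC : INR (4 * B * k) = C) by (rewrite !mult_INR; unfold C; simpl; ring).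
  assert (HC4 : 4 <= C) by (unfold C; nra).
  apply lt_INR in H; rewrite pow_INR, HC in H.
  assert (HlnC : 0 < ln C) by (rewrite <- ln_1; apply ln_increasing; lra).
  assert (H2 : ln (INR N) <= INR F ^ (2 * k + 1) * ln C).
  { rewrite <- pow_INR, <- ln_pow by lra.
    left; apply ln_increasing; [apply lt_0_INR; lia | exact H]. }
  assert (HFp : 0 < INR F ^ (2 * k + 1)) by (apply pow_lt; lra).
  assert (H3 : ln (ln (INR N)) <= INR (2 * k + 1) * ln (INR F) + ln (ln C)).
  { rewrite <- ln_pow, <- ln_mult by lra; destruct H2 as [H2 | ->]; [| lra].
    left; apply ln_increasing; lra. }
  pose proof (ln_le_sub1 (ln C) HlnC); pose proof (ln_le_sub1 C ltac:(lra)).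
  pose proof (ln_le_sub1 (INR F) ltac:(lra)).
  assert (HkF : INR (2 * k + 1) * ln (INR F) <= 3 * INR k * INR F).
  { apply Rmult_le_compat; try (apply pos_INR); try lra.
    - rewrite <- ln_1; destruct (Req_dec (INR F) 1) as [-> |]; [lra |].
      left; apply ln_increasing; lra.
    - rewrite plus_INR, mult_INR; simpl; lra. }
  unfold C in *; nra.
Qed.

Theorem theorem1 :
  forall d : nat, (2 <= d)%nat ->
  exists eps : R, (0 < eps)%R /\
  forall q : gpoly, has_degree q d -> intersective q ->
  exists C : R, (0 < C)%R /\
  forall (N : nat) (A : list GI),
    (3 <= N)%nat ->
    A <> nil ->
    NoDup A ->
    (forall x, In x A -> in_box N x) ->
    (forall x y z, In x A -> In y A -> x <> y -> gsub x y <> peval q z) ->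
    (INR (length A) / INR (N * N) <= C / Rpower (ln (ln (INR N))) eps)%R.
Proof.
  intros [| m] Hd; [lia |].
  set (n := (2 ^ S m)%nat).
  assert (Hn : 0 < INR (2 * n)).
  { apply lt_0_INR; assert (n <> 0)%nat by (apply Nat.pow_nonzero; lia); lia. }
  (* The bound on [ln (ln N)] is of order [1 / eta], that is [d0] to the power [-2 n] up to
     constants, with [n = 2^d]; solving for [d0] gives this exponent. *)
  exists (/ INR (2 * n)); split; [now apply Rinv_0_lt_compat |].
  intros q Hq Hint; destruct (density_bounded_by_steps q m Hq Hint) as [B [HB Hsteps]].
  set (F := (S m * S m + 5 * S m + 1)%nat) in *.
  (* This collects [ln (ln N) <= (3 F + 4 B) k], [k <= 2 / eta] and [d0^(2 n) = 8^n * eta]. *)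
  set (M := 2 * (3 * INR F + 4 * INR B) * 8 ^ n).
  assert (HM : 0 < M).
  { assert (1 <= INR B) by (apply (le_INR 1); exact HB).
    pose proof (pos_INR F); pose proof (pow_lt 8 n ltac:(lra)).
    unfold M; apply Rmult_lt_0_compat; lra. }
  exists (Rpower M (/ INR (2 * n))); split; [apply exp_pos |].
  intros N A HN Hnil Hnodup Hbox Havoid.
  assert (HN1 : (1 <= N)%nat) by lia.
  pose proof (length_le_density A N HN1 Hnodup Hbox) as Hlen.
  pose proof (density_le_1 A gzero gone N HN1) as Hden.
  set (d0 := INR (length A) / INR (N * N)) in *.
  assert (Hd0 : 0 < d0 <= 1).
  { split; [| lra]; apply Rdiv_lt_0_compat; apply lt_0_INR; [| nia].
    destruct A; [contradiction | simpl; lia]. }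
  set (eta := (d0 ^ 2 / 8) ^ n).
  assert (Hz : 0 < d0 ^ 2 / 8 <= 1) by (simpl; nra).
  assert (Heta : 0 < eta <= 1).
  { split; [apply pow_lt; lra |].
    rewrite <- (pow1 n); apply pow_incr; lra. }
  destruct (exists_nat_inv_le eta Heta) as [k [Hk [Hketa Hk2]]].
  (* Otherwise [2 k + 1] increments fit, with total gain at least [1 + eta / 2] because
     [k * eta >= 1], and the initial density would be negative. *)
  assert (HNk : (N < (4 * B * k) ^ (F ^ (2 * k + 1)))%nat).
  { apply Nat.nle_gt; intro Hle.
    assert (K : density A gzero gone N <= 1 - INR (2 * k + 1) * (eta / 2)).
    { apply (Hsteps A d0 k Havoid Hd0 Hk Hketa (2 * k + 1)%nat gzero gone N 1%nat).
      - discriminate.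
      - unfold gabs; simpl; lia.
      - rewrite Nat.mul_1_r; exact Hle.
      - exact Hlen. }
    assert (Hkr : 0 < INR k) by (apply lt_0_INR; lia).
    assert (1 <= INR k * eta).
    { apply (Rmult_le_compat_l (INR k)) in Hketa; [| lra]; rewrite Rinv_r in Hketa; lra. }
    rewrite plus_INR, mult_INR in K; simpl in K; nra. }
  destruct (lnln_pos N HN) as [_ Hl0].
  pose proof (lnln_tower_bound N B k F HN HB Hk ltac:(unfold F; lia) HNk) as Hl.
  set (l := ln (ln (INR N))) in *.
  assert (Hmain : d0 ^ (2 * n) * l <= M).
  { assert (HFB : 0 <= 3 * INR F + 4 * INR B) by (pose proof (pos_INR F); pose proof (pos_INR B); lra).
    assert (H1 : l <= (3 * INR F + 4 * INR B) * (2 / eta))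
      by (eapply Rle_trans; [exact Hl | now apply Rmult_le_compat_l]).
    assert (E : d0 ^ (2 * n) = eta * 8 ^ n).
    { unfold eta; rewrite <- Rpow_mult_distr, pow_mult; f_equal; field. }
    rewrite E; unfold M.
    apply Rle_trans with (eta * 8 ^ n * ((3 * INR F + 4 * INR B) * (2 / eta))).
    - apply Rmult_le_compat_l; [| exact H1].
      apply Rmult_le_pos; [lra | apply pow_le; lra].
    - right; field; lra. }
  assert (Hp : 0 < d0 ^ (2 * n)) by (apply pow_lt; lra).
  assert (E : d0 = Rpower (d0 ^ (2 * n)) (/ INR (2 * n))).
  { rewrite <- Rpower_pow, Rpower_mult, Rinv_r, Rpower_1; lra. }
  assert (HR : 0 < Rpower l (/ INR (2 * n))) by apply exp_pos.
  apply Rmult_le_reg_r with (Rpower l (/ INR (2 * n))); [exact HR |].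
  unfold Rdiv; rewrite Rmult_assoc, Rinv_l, Rmult_1_r by lra.
  rewrite E, Rpower_mult_distr by lra.
  apply Rle_Rpower_l; [left; now apply Rinv_0_lt_compat |].
  split; [now apply Rmult_lt_0_compat | exact Hmain].
Qed.
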